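(* Let $E,F,H\subset\mathbb{R}^2$ be compact sets with $\dim_{\mathcal H}(E)+\dim_{\mathcal H}(F)+\dim_{\mathcal H}(H)>4$. Then the set $$E\cdot(F+H)=\{x\cdot(y+z): x\in E,\ y\in F,\ z\in H\}\subset\mathbb{R}$$ has positive Lebesgue measure. The dimensional threshold $4$ is in general sharp: there exist compact sets $E,F,H\subset\mathbb{R}^2$ with $\dim_{\mathcal H}(E)+\dim_{\mathcal H}(F)+\dim_{\mathcal H}(H)=4$ such that $E\cdot(F+H)$ has Lebesgue measure zero.
   Context: $\dim_{\mathcal H}$ denotes Hausdorff dimension, and $x\cdot y$ is the usual dot product on $\mathbb{R}^2$. *)

(* Defs.v *)
From HB Require Import structures.
From mathcomp Require Import all_boot all_order all_algebra.
From mathcomp Require Import all_classical all_reals all_analysis.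

Set Implicit Arguments.
Unset Strict Implicit.
Unset Printing Implicit Defensive.

Import Order.TTheory GRing.Theory Num.Theory.
Import numFieldNormedType.Exports.

Local Open Scope classical_set_scope.
Local Open Scope ring_scope.
Local Open Scope ereal_scope.

Definition dotv (R : realType) (n : nat) (x y : 'rV[R]_n) : R :=
  (\sum_(i < n) x ord0 i * y ord0 i)%R.

(* The library norm on 'rV[R]_n is the sup norm; diameters below are Euclidean.
   The library topology on 'rV[R]_n is the usual one. *)
Definition enorm (R : realType) (n : nat) (x : 'rV[R]_n) : R :=
  Num.sqrt (dotv x x).

(* The diameter of the empty set is -oo here. *)
Definition ediam (R : realType) (n : nat) (A : set 'rV[R]_n) : \bar R :=
  ereal_sup [set (enorm (x - y))%:E | x in A & y in A].

(* (diam A)^s, with the usual convention that the empty set contributes 0 and,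
   since poweR 0 0 = 1, a point contributes 1 when s = 0. *)
Definition diam_pow (R : realType) (n : nat) (s : R) (A : set 'rV[R]_n) :
    \bar R :=
  if A == set0 then 0 else poweR (ediam A) s.

Definition hausdorff_premeasure (R : realType) (n : nat) (s delta : R)
    (A : set 'rV[R]_n) : \bar R :=
  ereal_inf [set \sum_(0 <= k <oo) diam_pow s (U k) | U in
    [set U : nat -> set 'rV[R]_n |
      A `<=` \bigcup_k U k /\ forall k, ediam (U k) <= delta%:E]].

Definition hausdorff_measure (R : realType) (n : nat) (s : R)
    (A : set 'rV[R]_n) : \bar R :=
  ereal_sup [set hausdorff_premeasure s delta A |
    delta in [set d : R | (0 < d)%R]].

Definition hausdorff_dim (R : realType) (n : nat) (A : set 'rV[R]_n) : \bar R :=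
  ereal_inf [set s%:E |
    s in [set s : R | (0 <= s)%R /\ hausdorff_measure s A = 0]].

Definition sum_set (R : realType) (n : nat) (A B : set 'rV[R]_n) :
    set 'rV[R]_n :=
  [set (x + y)%R | x in A & y in B].

Definition dot_set (R : realType) (n : nat) (A B : set 'rV[R]_n) : set R :=
  [set dotv x y | x in A & y in B].

(* Main.v *)
Require Import Defs.
From HB Require Import structures.
From mathcomp Require Import all_boot all_order all_algebra.
From mathcomp Require Import complex ring lra zify.
From mathcomp Require Import all_classical all_reals all_analysis.
From mathcomp Require Import measurable_realfun.

(** Positive measure is proved by a Fourier argument carried out on grids, so that
    every sum is finite and all constants are uniform in the mesh.

    Fix N = 2^k. Choose exponents below the three dimensions whose sum still
    exceeds 4. A discrete Frostman lemma ([frostman_tree], [discrete_frostman]) gives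
    weights mu, nu, la on the grid points near E, F, H: the total masses are bounded
    below, and a ball of radius 2^-j has mass O(al^j), O(be^j), O(ga^j)
    respectively, where 16 al be ga < 1. The weights push forward under
    x . (y + z) to a measure on the line whose Fourier transform is

      eta(t) = sum over x of mu(x) nu^(t x) la^(t x).

    If the sum of |eta(t)|^2 over t < N is bounded, Fejer's kernel
    ([coincidence_le]) shows that two values of x . (y + z) are within 1/N of each
    other with probability O(1/N), and Cauchy-Schwarz ([sqr_sum_le_size]) makes
    the values occupy at least c N of the intervals of length 1/N. As c does not
    depend on N, a compact set of values cannot be null ([lebesgue_gt0]).

    It remains to bound the sum over T <= t < 2T, with T = 2^j. Two facts combine.
    For fixed t, a double large sieve inequality in the variables x and z
    ([double_large_sieve]) replaces the decay of oscillatory integrals: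

      |eta(t)|^2 <= C T^2 al^j ga^j * sum over x of mu(x) |nu^(t x)|^2.

    For fixed x away from the origin, the sum over t of |nu^(t x)|^2 is O(T) times
    the largest nu-mass of a strip of width 1/T orthogonal to x ([time_sieve]),
    and such a strip is covered by O(T) balls of radius 1/T ([strip_le]), which
    gives O(T^2 be^j). Altogether the dyadic block contributes
    O((16 al be ga)^j), and the geometric series converges ([energy_le]).
    The part of E near the origin is discarded beforehand ([far_restrict]): it
    carries little mass because its exponent is positive.

    For sharpness take E reduced to the origin and F = H the unit square, whose
    dimension is 2 by comparison with area. *)

Set Implicit Arguments.
Unset Strict Implicit.
Unset Printing Implicit Defensive.

Import Order.TTheory GRing.Theory Num.Theory.
Import numFieldNormedType.Exports.
Local Open Scope ring_scope.

(** * Squared moduli and the large sieve inequality *)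

Section squared_modulus.
Local Open Scope complex_scope.
Context (R : realType).
Implicit Types z w : R[i].

Definition sqn z : R := complex.Re z ^+ 2 + complex.Im z ^+ 2.

(** Conjugation spelled out on coordinates, so that the identities below are ring
    identities between real and imaginary parts. *)
Definition cj z : R[i] := Complex (complex.Re z) (- complex.Im z).

Lemma sqn_ge0 z : 0 <= sqn z.
Proof. by rewrite addr_ge0 ?sqr_ge0. Qed.

Lemma sqnE z : sqn z = complex.Re (z * cj z).
Proof. by case: z => a b; rewrite /sqn /=; ring. Qed.

Lemma sqnM z w : sqn (z * w) = sqn z * sqn w.
Proof. by case: z w => [a b] [c d]; rewrite /sqn /=; ring. Qed.

Lemma sqnV z : sqn z^-1 = (sqn z)^-1.
Proof.
have [->|z0] := eqVneq z 0.
  by rewrite invr0 /sqn /= expr0n addr0 invr0.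
have : sqn z * sqn z^-1 = 1 by rewrite -sqnM mulfV// /sqn /= expr1n expr0n addr0.
move=> h; have s0 : sqn z != 0.
  by apply: contra_eq_neq h => ->; rewrite mul0r eq_sym oner_eq0.
by apply: (mulfI s0); rewrite h mulfV.
Qed.

Lemma sqnC (x : R) : sqn x%:C = x ^+ 2.
Proof. by rewrite /sqn /= expr0n addr0. Qed.

Lemma sqn_cj z : sqn (cj z) = sqn z.
Proof. by case: z => a b; rewrite /sqn /= sqrrN. Qed.

Lemma Re_sum (I : Type) (r : seq I) (p : pred I) (F : I -> R[i]) :
  complex.Re (\sum_(i <- r | p i) F i) = \sum_(i <- r | p i) complex.Re (F i).
Proof. by apply: (big_morph _ _ _) => // -[a b] [c d]. Qed.

Lemma Im_sum (I : Type) (r : seq I) (p : pred I) (F : I -> R[i]) :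
  complex.Im (\sum_(i <- r | p i) F i) = \sum_(i <- r | p i) complex.Im (F i).
Proof. by apply: (big_morph _ _ _) => // -[a b] [c d]. Qed.

Lemma cj_sum (I : Type) (r : seq I) (p : pred I) (F : I -> R[i]) :
  cj (\sum_(i <- r | p i) F i) = \sum_(i <- r | p i) cj (F i).
Proof.
apply: (big_morph _ _ _) => [[a b] [c d]|]; rewrite /cj /=; last by rewrite oppr0.
by congr Complex; rewrite opprD.
Qed.

Lemma ReZ (x : R) z : complex.Re (x%:C * z) = x * complex.Re z.
Proof. by case: z => a b /=; rewrite mul0r subr0. Qed.

Lemma ImZ (x : R) z : complex.Im (x%:C * z) = x * complex.Im z.
Proof. by case: z => a b /=; rewrite mul0r addr0. Qed.

Lemma cjZ (x : R) z : cj (x%:C * z) = x%:C * cj z.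
Proof. by case: z => a b; rewrite /cj /=; congr Complex; ring. Qed.

Lemma cjM z w : cj (z * w) = cj z * cj w.
Proof. by case: z w => [a b] [c d]; rewrite /cj /=; congr Complex; ring. Qed.

Lemma Re_mul_cj_le z w : complex.Re (z * cj w) <= (sqn z + sqn w) / 2.
Proof.
case: z w => [a b] [c d]; rewrite /sqn /=.
have := sqr_ge0 (a - c); have := sqr_ge0 (b - d).
rewrite !sqrrB => h1 h2; lra.
Qed.

Lemma sqn_sum (I : finType) (F : I -> R[i]) :
  sqn (\sum_i F i) = \sum_i \sum_j complex.Re (F i * cj (F j)).
Proof.
rewrite sqnE cj_sum mulr_suml Re_sum; apply: eq_bigr => i _.
by rewrite mulr_sumr Re_sum.
Qed.

(** Cauchy-Schwarz, by the symmetric form 2 f i f j <= (f i)^2 + (f j)^2. *)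
Lemma sqr_wsum_le (I : finType) (w f : I -> R) : (forall i, 0 <= w i) ->
  (\sum_i w i * f i) ^+ 2 <= (\sum_i w i) * \sum_i w i * f i ^+ 2.
Proof.
move=> w0.
have -> : (\sum_i w i * f i) ^+ 2 =
   \sum_i \sum_j w i * w j * (f i * f j).
  rewrite expr2 mulr_suml; apply: eq_bigr => i _.
  by rewrite mulr_sumr; apply: eq_bigr => j _; ring.
have -> : (\sum_i w i) * (\sum_i w i * f i ^+ 2) =
   \sum_i \sum_j w i * w j * ((f i ^+ 2 + f j ^+ 2) / 2).
  have E1 : (\sum_i w i) * (\sum_i w i * f i ^+ 2) =
      \sum_i \sum_j w i * w j * f j ^+ 2.
    rewrite mulr_suml; apply: eq_bigr => i _.
    by rewrite mulr_sumr; apply: eq_bigr => j _; ring.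
  have E2 : (\sum_i w i) * (\sum_i w i * f i ^+ 2) =
      \sum_i \sum_j w i * w j * f i ^+ 2.
    rewrite E1 exchange_big; apply: eq_bigr => i _.
    by apply: eq_bigr => j _; ring.
  set X := LHS; have -> : X = X / 2 + X / 2 by field.
  rewrite {1}/X E2 /X E1 !mulr_suml -big_split; apply: eq_bigr => i _ /=.
  by rewrite !mulr_suml -big_split; apply: eq_bigr => j _ /=; field.
apply: ler_sum => i _; apply: ler_sum => j _.
apply: ler_wpM2l; first exact: mulr_ge0.
by have := sqr_ge0 (f i - f j); rewrite sqrrB => h; lra.
Qed.

Lemma sqn_wsum_le (I : finType) (w : I -> R) (z : I -> R[i]) :
  (forall i, 0 <= w i) ->
  sqn (\sum_i (w i)%:C * z i) <= (\sum_i w i) * \sum_i w i * sqn (z i).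
Proof.
move=> w0; rewrite /sqn Re_sum Im_sum.
under eq_bigr do rewrite ReZ.
under [X in _ + X ^+ 2]eq_bigr do rewrite ImZ.
under [X in _ <= _ * X]eq_bigr do rewrite mulrDr.
rewrite big_split mulrDr lerD//; exact: sqr_wsum_le.
Qed.

(** Orthogonality of the rows of chi leaves only the pairs related by e in the
    expanded square. Each such term is at most half the sum of the two squares,
    and by symmetry of e each square is then counted with weight at most La. *)
Lemma large_sieve (A V : finType) (chi : A -> V -> R[i]) (e : rel A) (c La : R)
    (mu : A -> R) (g : A -> R[i]) :
  (forall a, 0 <= mu a) -> 0 <= c -> symmetric e ->
  (forall a b, \sum_v chi a v * cj (chi b v) = if e a b then c%:C else 0) ->
  (forall a, \sum_(b | e a b) mu b <= La) ->
  \sum_v sqn (\sum_a (mu a)%:C * (g a * chi a v)) <=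
  c * La * \sum_a mu a * sqn (g a).
Proof.
move=> mu0 c0 es orth hLa.
have -> : \sum_v sqn (\sum_a (mu a)%:C * (g a * chi a v)) =
    \sum_a \sum_b (if e a b then c * (mu a * mu b * complex.Re (g a * cj (g b))) else 0).
  under eq_bigr do rewrite sqn_sum.
  rewrite exchange_big; apply: eq_bigr => a _.
  rewrite exchange_big; apply: eq_bigr => b _.
  transitivity (complex.Re ((mu a * mu b)%:C * (g a * cj (g b) *
     \sum_v chi a v * cj (chi b v)))).
    rewrite !mulr_sumr Re_sum; apply: eq_bigr => v _; congr complex.Re.
    by rewrite cjZ (cjM (g b)) rmorphM; ring.
  rewrite orth; case: ifP => _; last by rewrite !mulr0.
  by rewrite ReZ [_ * c%:C]mulrC ReZ; ring.
apply: (@le_trans _ _ (\sum_a \sum_b (if e a b then c *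
   (mu a * mu b * ((sqn (g a) + sqn (g b)) / 2)) else 0))).
  apply: ler_sum => a _; apply: ler_sum => b _; case: ifP => // _.
  by apply: ler_wpM2l => //; apply: ler_wpM2l; rewrite ?mulr_ge0// Re_mul_cj_le.
pose S := \sum_a \sum_b (if e a b then c * (mu a * mu b * sqn (g a)) else 0).
have S2 : S = \sum_a \sum_b (if e a b then c * (mu a * mu b * sqn (g b)) else 0).
  rewrite /S exchange_big; apply: eq_bigr => a _; apply: eq_bigr => b _.
  by rewrite es; case: ifP => // _; ring.
have -> : \sum_a \sum_b (if e a b then c *
   (mu a * mu b * ((sqn (g a) + sqn (g b)) / 2)) else 0) = S.
  have -> : S = S / 2 + S / 2 by field.
  rewrite {2}S2 {1}/S !mulr_suml -big_split; apply: eq_bigr => a _ /=.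
  rewrite !mulr_suml -big_split; apply: eq_bigr => b _ /=.
  by case: ifP => _; field.
rewrite /S mulr_sumr; apply: ler_sum => a _.
rewrite -big_mkcond /= -mulr_sumr -mulr_suml -mulr_sumr.
rewrite -[c * La * _]mulrA ler_wpM2l// mulrAC [leRHS]mulrC.
by rewrite ler_wpM2l// mulr_ge0 ?sqn_ge0.
Qed.

End squared_modulus.

(** * Additive characters modulo P *)

Section characters.
Local Open Scope complex_scope.
Context (R : realType) (P : nat) (P0 : (0 < P)%N).

Definition ch (k : int) : R[i] :=
  Complex (cos (2 * pi * k%:~R / P%:R)) (sin (2 * pi * k%:~R / P%:R)).

Lemma chD k l : ch (k + l) = ch k * ch l.
Proof.
rewrite /ch rmorphD mulrDr mulrDl cosD sinD.
by congr Complex; rewrite addrC.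
Qed.

Lemma ch0 : ch 0 = 1.
Proof. by rewrite /ch mulr0 mul0r cos0 sin0. Qed.

Lemma cj_ch k : cj (ch k) = ch (- k).
Proof. by rewrite /ch /cj /= rmorphN mulrN mulNr cosN sinN. Qed.

Lemma chB k l : ch k * cj (ch l) = ch (k - l).
Proof. by rewrite cj_ch -chD. Qed.

Lemma sqn_ch k : sqn (ch k) = 1.
Proof. by rewrite /sqn /= cos2Dsin2. Qed.

Lemma ch_exp k n : ch k ^+ n = ch (k * n%:Z).
Proof.
elim: n => [|n IH]; first by rewrite expr0 mulr0 ch0.
by rewrite exprSr IH -chD -{2}[k]mulr1 -mulrDr; congr (ch (k * _)); lia.
Qed.

Let Pr0 : 0 < P%:R :> R. Proof. by rewrite ltr0n. Qed.

Lemma chP k : ch k ^+ P = 1.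
Proof.
rewrite ch_exp /ch rmorphM /= mulrA mulfK ?gt_eqF//.
have -> : 2 * pi * k%:~R = (pi *+ 2) *~ k :> R by rewrite -[RHS]mulrzr mulr_natl.
have cs2 : forall n : nat, cos ((pi *+ 2) *+ n) = 1 :> R /\ sin ((pi *+ 2) *+ n) = 0 :> R.
  elim=> [|n [IHc IHs]]; first by rewrite cos0 sin0.
  by rewrite (mulrSr (pi *+ 2)) cosD (sinD (_ *+ n)) cos2pi sin2pi IHc IHs !(mulr0, mul0r, mulr1, mul1r, subr0, addr0).
case: k => n; first by rewrite -!pmulrn; have [-> ->] := cs2 n.
by rewrite NegzE mulrNz cosN sinN -!pmulrn; have [-> ->] := cs2 n.+1; rewrite oppr0.
Qed.

Lemma ch_neq1 (k : int) : k != 0 -> `|k| < P%:Z -> ch k != 1.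
Proof.
move=> k0 kP; apply/eqP => /(congr1 (@complex.Re R)) /=.
set x : R := pi * k%:~R / P%:R.
have -> : 2 * pi * k%:~R / P%:R = x *+ 2 by rewrite /x -mulr_natl; ring.
rewrite cos_mulr2n => hc.
have hs : sin x ^+ 2 = 0 by have := cos2Dsin2 x; rewrite mulr2n in hc; lra.
have [xpos|xneg|xe] := ltrgt0P x; last first.
- by move: xe; apply/eqP; rewrite !mulf_neq0 ?invr_neq0 ?intr_eq0 ?(gt_eqF (pi_gt0 R)) ?(gt_eqF Pr0).
- have : 0 < sin (- x).
    apply: sin_gt0_pi; rewrite oppr_gt0 xneg/= /x -mulNr -mulrN ltr_pdivrMr//.
    rewrite ltr_pM2l ?pi_gt0//; apply: (@le_lt_trans _ _ (`|k|%:~R)).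
      by rewrite -rmorphN ler_int; lia.
    by rewrite -[P%:R]/(P%:Z%:~R) ltr_int.
  by move/eqP: hs; rewrite sqrf_eq0 sinN => /eqP ->; rewrite oppr0 ltxx.
- have : 0 < sin x.
    apply: sin_gt0_pi; rewrite xpos/= /x ltr_pdivrMr//.
    rewrite ltr_pM2l ?pi_gt0//; apply: (@le_lt_trans _ _ (`|k|%:~R)).
      by rewrite ler_int; lia.
    by rewrite -[P%:R]/(P%:Z%:~R) ltr_int.
  by move/eqP: hs; rewrite sqrf_eq0 => /eqP ->; rewrite ltxx.
Qed.

(** The shift off lets the sum run over any window of P consecutive integers; it
    only contributes a phase. *)
Lemma sum_ch (k off : int) : `|k| < P%:Z ->
  \sum_(v < P) ch (k * (v%:Z - off)) = if k == 0 then P%:R%:C else 0.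
Proof.
move=> kP; case: eqVneq => [->|k0].
  under eq_bigr do rewrite mul0r ch0.
  by rewrite sumr_const card_ord rmorph_nat.
have -> : \sum_(v < P) ch (k * (v%:Z - off)) = ch (- (k * off)) * \sum_(v < P) ch k ^+ v.
  rewrite mulr_sumr; apply: eq_bigr => v _.
  by rewrite ch_exp -chD; congr ch; ring.
have : (ch k - 1) * \sum_(v < P) ch k ^+ v = 0 by rewrite -subrX1 chP subrr.
by move/eqP; rewrite mulf_eq0 subr_eq0 (negPf (ch_neq1 k0 kP)) => /eqP ->; rewrite mulr0.
Qed.

(** The angle is at most pi / 4, where the cosine is at least 1 / sqrt 2. *)
Lemma Re_ch_ge (k : int) : `|k| *+ 8 <= P%:Z -> (2^-1 : R) <= complex.Re (ch k).
Proof.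
move=> kP; rewrite /ch /=; set x := _ / P%:R.
have hx : - (pi / 4) <= x <= pi / 4.
  have kP8 : `|k|%:~R *+ 8 <= P%:R :> R.
    by rewrite -[P%:R]/(P%:Z%:~R) -rmorphMn ler_int.
  rewrite -ler_norml /x normrM normfV normrM (gtr0_norm (mulr_gt0 _ (pi_gt0 R)))//.
  rewrite (gtr0_norm Pr0) ler_pdivrMr// -intr_norm -[pi / 4]mulr1.
  have -> : 2 * pi * `|k|%:~R = pi / 4 * (`|k|%:~R *+ 8) :> R by rewrite -mulr_natr; field.
  by rewrite mulr1 ler_wpM2l// divr_ge0// pi_ge0.
have pi0 := pi_gt0 R.
have c1 : 0 <= cos x by apply: cos_ge0_pihalf; move/andP: hx => [? ?]; lra.
have : 0 <= cos (x *+ 2).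
  apply: cos_ge0_pihalf; rewrite -mulr_natl; case/andP: hx; clearbody x => h1 h2; apply/andP; split; lra.
rewrite cos_mulr2n -mulr_natl; move: c1; set c := cos x; clearbody c => c1 c2; rewrite leNgt; apply/negP => h.
have h2 : c * c <= 2^-1 * c by rewrite ler_wpM2r // (ltW h).
rewrite expr2 in c2; clear kP hx; move: (c * c) h2 c2 => d h2 c2. lra.
Qed.

End characters.

(** * Sieve inequalities in time and in space *)

Section sieves.
Local Open Scope complex_scope.
Context (R : realType) (P : nat) (P0 : (0 < P)%N).
Local Notation ch := (@ch R P).

Lemma sqn_ge_Re (z : R[i]) (x : R) : 0 <= x -> x <= complex.Re z -> x ^+ 2 <= sqn z.
Proof.
move=> x0 xz; rewrite /sqn -[leLHS]addr0 lerD ?sqr_ge0//.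
by rewrite ler_sqr ?nnegrE// (le_trans x0).
Qed.

(** Phases confined to an eighth of a turn do not cancel. Such sums serve as
    bump functions whose Fourier support is explicit. *)
Lemma sqn_sum_ch_ge (T : finType) (k : T -> int) :
  (forall i, `|k i| *+ 8 <= P%:Z) ->
  (#|T|%:R / 2) ^+ 2 <= sqn (\sum_i ch (k i)).
Proof.
move=> hk; apply: sqn_ge_Re; first by rewrite divr_ge0.
rewrite Re_sum; apply: (@le_trans _ _ (\sum_(i : T) 2^-1)).
  by rewrite sumr_const -[leRHS]mulr_natl lexx.
by apply: ler_sum => i _; apply: Re_ch_ge.
Qed.

(** Frequencies that differ by less than P are orthogonal modulo P unless they
    are equal. *)
Lemma large_sieve1 (A : finType) (f : A -> int) (mu : A -> R) (g : A -> R[i]) (La : R) :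
  (forall a, 0 <= mu a) ->
  (forall a b, `|f a - f b| < P%:Z) ->
  (forall a, \sum_(b | f a == f b) mu b <= La) ->
  \sum_(v < P) sqn (\sum_a (mu a)%:C * (g a * ch (f a * v%:Z))) <=
  P%:R * La * \sum_a mu a * sqn (g a).
Proof.
move=> mu0 fP hLa.
apply: (@large_sieve _ _ _ (fun a (v : 'I_P) => ch (f a * v%:Z))
  (fun a b => f a == f b)) => //.
- move=> a b.
  under eq_bigr do rewrite chB -mulrBl -[X in _ * X]subr0.
  by rewrite (sum_ch R P0 _ (fP a b)) subr_eq0.
Qed.

Lemma large_sieve2 (A : finType) (f1 f2 : A -> int) (mu : A -> R) (g : A -> R[i])
   (La : R) (off : int) :
  (forall a, 0 <= mu a) ->
  (forall a b, `|f1 a - f1 b| < P%:Z) ->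
  (forall a b, `|f2 a - f2 b| < P%:Z) ->
  (forall a, \sum_(b | (f1 a == f1 b) && (f2 a == f2 b)) mu b <= La) ->
  \sum_(v : 'I_P * 'I_P) sqn (\sum_a (mu a)%:C *
     (g a * ch (f1 a * (v.1%:Z - off) + f2 a * (v.2%:Z - off)))) <=
  P%:R ^+ 2 * La * \sum_a mu a * sqn (g a).
Proof.
move=> mu0 f1P f2P hLa.
apply: (@large_sieve _ _ _ (fun a (v : 'I_P * 'I_P) =>
     ch (f1 a * (v.1%:Z - off) + f2 a * (v.2%:Z - off)))
  (fun a b => (f1 a == f1 b) && (f2 a == f2 b))) => //.
- by move=> a b; rewrite /= eq_sym [f2 a == _]eq_sym.
- move=> a b.
  transitivity ((\sum_(v < P) ch ((f1 a - f1 b) * (v%:Z - off))) *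
                (\sum_(v < P) ch ((f2 a - f2 b) * (v%:Z - off)))).
    rewrite big_distrlr pair_big /=; apply: eq_bigr => -[u v] _ /=.
    by rewrite chB -chD; congr ch; ring.
  rewrite !sum_ch// !subr_eq0.
  by do 2 case: eqP => _; rewrite ?mul0r ?mulr0//= -rmorphM.
Qed.

(** The sum over t < U is dominated by the sum over a full period of the same
    terms times |sum over j < J of ch (j t)|^2 / J^2, since this factor is at least
    1/4 on t < U. The product is a trigonometric sum with frequencies s l + j, and
    two of them can coincide only when s k and s l differ by less than J. *)
Lemma time_sieve (L : finType) (s : L -> int) (nu : L -> R) (U J Y : nat) (La : R) :
  (0 < J)%N -> (8 * J * U <= P)%N -> (J + 2 * Y <= P)%N ->
  0 <= La -> (forall l, 0 <= nu l) -> (forall l, `|s l| <= Y%:Z) ->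
  (forall l, \sum_(k | `|s k - s l| < J%:Z) nu k <= La) ->
  \sum_(t < U) sqn (\sum_l (nu l)%:C * ch (t%:Z * s l)) <=
  4 * (P%:R / J%:R) * La * \sum_l nu l.
Proof.
move=> J0 hU hY La0 nu0 sY hLa.
have Jr : 0 < J%:R :> R by rewrite ltr0n.
have [->|U0] := posnP U.
  by rewrite big_ord0 !mulr_ge0 ?sumr_ge0 ?invr_ge0.
have UP : (U <= P)%N by nia.
(* H t is the sum at t times a Fejer-type factor, itself a sum over frequencies
   s l + j with j < J. *)
pose H (t : 'I_P) := sqn (\sum_(a : L * 'I_J) (nu a.1)%:C *
   ((1 : R[i]) * ch ((s a.1 + a.2%:Z) * t%:Z))).
have HE t : H t = sqn (\sum_(j < J) ch (j%:Z * t%:Z)) *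
   sqn (\sum_l (nu l)%:C * ch (t%:Z * s l)).
  rewrite /H -sqnM; congr sqn; rewrite mulrC big_distrlr pair_big /=.
  by apply: eq_bigr => -[l j] _ /=; rewrite mul1r -mulrA -chD; congr (_ * ch _); ring.
have H0 t : 0 <= H t by apply: sqn_ge0.
have key : \sum_(t < U) sqn (\sum_l (nu l)%:C * ch (t%:Z * s l)) * (J%:R / 2) ^+ 2 <=
   \sum_(t < P) H t.
  rewrite (big_ord_widen P
    (fun t => sqn (\sum_l (nu l)%:C * ch (t%:Z * s l)) * (J%:R / 2) ^+ 2) UP).
  rewrite [leRHS](bigID (fun t : 'I_P => (t < U)%N))/= -[leLHS]addr0 lerD ?sumr_ge0//.
  apply: ler_sum => t tU; rewrite HE mulrC ler_wpM2r ?sqn_ge0//.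
  rewrite -[X in (X%:R / 2)]card_ord; apply: sqn_sum_ch_ge => j.
  rewrite ger0_norm//; have := ltn_ord j; nia.
have := @large_sieve1 _ (fun a : L * 'I_J => s a.1 + a.2%:Z) (fun a => nu a.1) (fun=> 1) La
   (fun a => nu0 a.1).
have h1 (a b : L * 'I_J) : `|s a.1 + a.2%:Z - (s b.1 + b.2%:Z)| < P%:Z.
  have := sY a.1; have := sY b.1; have := ltn_ord a.2; have := ltn_ord b.2; lia.
have h2 (a : L * 'I_J) : \sum_(b : L * 'I_J | s a.1 + a.2%:Z == s b.1 + b.2%:Z) nu b.1 <= La.
  apply: le_trans (hLa a.1).
  rewrite (eq_bigr (fun b : L * 'I_J => nu b.1))//.
  rewrite -(pair_big_dep xpredT (fun k (j : 'I_J) => s a.1 + a.2%:Z == s k + j%:Z) (fun k _ => nu k)) /=.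
  rewrite [leRHS]big_mkcond; apply: ler_sum => k _.
  case: ifPn => hk.
    rewrite sumr_const -[leRHS]mulr1n ler_wpMn2l//.
    apply/card_le1_eqP => j j' jE jE'; apply/val_inj.
    have {}jE : s a.1 + a.2%:Z = s k + (j : 'I_J)%:Z by apply/eqP; exact: jE.
    have {}jE' : s a.1 + a.2%:Z = s k + (j' : 'I_J)%:Z by apply/eqP; exact: jE'.
    by rewrite /=; lia.
  rewrite big_pred0// => j; apply/negP => /eqP jE.
  have := ltn_ord j; have := ltn_ord a.2; lia.
move=> /(_ h1 h2) ls.
rewrite -mulr_suml in key; have := le_trans key ls.
rewrite -ler_pdivlMr ?exprn_gt0 ?divr_gt0// => h; apply: le_trans h _.
have -> : \sum_(a : L * 'I_J) nu a.1 * sqn 1 = J%:R * \sum_l nu l.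
  rewrite -(pair_big xpredT xpredT (fun k _ => nu k * sqn 1)) /= mulr_sumr.
  apply: eq_bigr => l _; rewrite sumr_const card_ord mulr_natl; congr (_ *+ _).
  by rewrite /sqn /= expr1n expr0n addr0 mulr1.
rewrite le_eqVlt; apply/orP; left; apply/eqP; field.
by rewrite gt_eqF.
Qed.

(** Fejer's kernel |sum over t < U of ch (t x)|^2 is nonnegative, and at least
    U^2 / 4 when |x| < J; its expansion involves the differences t - u. *)
Lemma coincidence_le (A : finType) (w : A -> R) (s : A -> int) (J U : nat) :
  (0 < U)%N -> (8 * J * U <= P)%N -> (forall a, 0 <= w a) ->
  \sum_a \sum_(b | `|s a - s b| < J%:Z) w a * w b <=
  4 / U%:R ^+ 2 * \sum_(t < U) \sum_(u < U)
     sqn (\sum_a (w a)%:C * ch ((t%:Z - u%:Z) * s a)).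
Proof.
move=> U0 hU w0.
have Ur : 0 < U%:R :> R by rewrite ltr0n.
have -> : \sum_(t < U) \sum_(u < U) sqn (\sum_a (w a)%:C * ch ((t%:Z - u%:Z) * s a)) =
  \sum_a \sum_b w a * w b * sqn (\sum_(t < U) ch (t%:Z * (s a - s b))).
  transitivity (\sum_(t < U) \sum_(u < U) \sum_a \sum_b w a * w b *
      complex.Re (ch ((t%:Z - u%:Z) * (s a - s b)))).
    apply: eq_bigr => t _; apply: eq_bigr => u _; rewrite sqn_sum.
    apply: eq_bigr => a _; apply: eq_bigr => b _.
    by rewrite cjZ mulrACA -rmorphM chB ReZ mulrBr.
  under eq_bigr do rewrite exchange_big; rewrite exchange_big.
  apply: eq_bigr => a _.
  under eq_bigr do rewrite exchange_big; rewrite exchange_big.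
  apply: eq_bigr => b _.
  rewrite sqn_sum mulr_sumr; apply: eq_bigr => t _; rewrite mulr_sumr.
  by apply: eq_bigr => u _; rewrite chB mulrBl.
rewrite mulr_sumr; apply: ler_sum => a _; rewrite mulr_sumr big_mkcond.
apply: ler_sum => b _; rewrite mulrCA; case: ifPn => h; last first.
  by rewrite !mulr_ge0 ?invr_ge0 ?exprn_ge0 ?sqn_ge0 ?ler0n.
rewrite -[leLHS]mulr1 ler_wpM2l ?mulr_ge0//.
rewrite mulrAC ler_pdivlMr ?exprn_gt0// mul1r.
have -> : U%:R ^+ 2 = 4 * (#|'I_U|%:R / 2) ^+ 2 :> R by rewrite card_ord; field.
rewrite ler_wpM2l//; apply: sqn_sum_ch_ge => t.
by rewrite normrM ger0_norm//; have := ltn_ord t; nia.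
Qed.

(** Exchanging the sums, the value of G at v is counted with the mass of the
    points l that have v in their window. Coordinates are shifted by X to become
    residues in the range below P. *)
Lemma window_sum_le (L : finType) (la : L -> R) (q1 q2 : L -> int) (K X : nat)
    (S : R) (G : int -> int -> R) :
  (forall l, `|q1 l| <= X%:Z) -> (forall l, `|q2 l| <= X%:Z) -> (2 * X + K <= P)%N ->
  (forall x y, 0 <= G x y) -> (forall l, 0 <= la l) ->
  (forall z1 z2 : int, \sum_(l | (`|q1 l - z1| < K%:Z) && (`|q2 l - z2| < K%:Z)) la l <= S) ->
  \sum_l la l * \sum_(h : 'I_K * 'I_K) G (q1 l + h.1%:Z) (q2 l + h.2%:Z) <=
  S * \sum_(v : 'I_P * 'I_P) G (v.1%:Z - X%:Z) (v.2%:Z - X%:Z).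
Proof.
move=> q1X q2X hP G0 la0 hS.
pose near l (v : 'I_P * 'I_P) := (`|q1 l - (v.1%:Z - X%:Z)| < K%:Z)
    && (`|q2 l - (v.2%:Z - X%:Z)| < K%:Z).
apply: (@le_trans _ _ (\sum_l la l *
   \sum_(v : 'I_P * 'I_P | near l v) G (v.1%:Z - X%:Z) (v.2%:Z - X%:Z))); last first.
  under eq_bigr do rewrite mulr_sumr.
  rewrite (exchange_big_dep xpredT)//= mulr_sumr; apply: ler_sum => v _.
  by rewrite -mulr_suml ler_wpM2r ?hS.
apply: ler_sum => l _; rewrite ler_wpM2l//.
have pf (q : int) (h : 'I_K) : `|q| <= X%:Z -> (absz (q + h%:Z + X%:Z)%R < P)%N.
  by move=> qX; have := ltn_ord h; lia.
pose e (h : 'I_K * 'I_K) := (Ordinal (pf _ h.1 (q1X l)), Ordinal (pf _ h.2 (q2X l))).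
have eK (q : int) (h : 'I_K) : `|q| <= X%:Z -> (absz (q + h%:Z + X%:Z)%R)%:Z - X%:Z = q + h%:Z.
  by move=> qX; have := ltn_ord h; lia.
have e_inj : injective e.
  move=> [a b] [c d] /(congr1 (fun v => (val v.1, val v.2))) [].
  move: (q1X l) (q2X l) => /= ? ? ? ?.
  by congr pair; apply/val_inj => /=; lia.
rewrite (eq_bigr (fun h => G ((e h).1%:Z - X%:Z) ((e h).2%:Z - X%:Z))); last first.
  by move=> h _; rewrite !eK.
rewrite -(big_imset (fun v : 'I_P * 'I_P => G (v.1%:Z - X%:Z) (v.2%:Z - X%:Z)) (in2W e_inj)) /=.
rewrite big_mkcond [leRHS]big_mkcond /=; apply: ler_sum => v _.
case: imsetP => [[h _ ->]|_]; last by case: ifP.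
rewrite /near !eK//; case: ifPn => // /negP[].
by move: h => [h1 h2]; have := ltn_ord h1; have := ltn_ord h2; rewrite /= => ? ?; apply/andP; split; lia.
Qed.

End sieves.

Section double_sieve.
Local Open Scope complex_scope.
Context (R : realType) (P : nat) (P0 : (0 < P)%N).
Local Notation ch := (@ch R P).

(** The inequality of Bombieri and Iwaniec for the bilinear form with kernel
    ch (t p . q) on two planar families. As a function of q, the inner sum varies
    little within a window of side K, so its square is bounded by an average over
    the window, and la enters through its mass there. The averages are then
    extended to a full period modulo P, where orthogonality lets mu enter through
    pairs of points at distance less than K. *)
Lemma double_large_sieve (M L : finType) (mu : M -> R) (p1 p2 : M -> int)
    (la : L -> R) (q1 q2 : L -> int) (g : M -> R[i]) (t K J X : nat) (Lmu Lla : R) :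
  (0 < K)%N -> (0 < J)%N -> (J <= t * K)%N ->
  (16 * t * X * K <= P)%N -> (8 * J * (X + K) <= P)%N -> (J + 2 * t * X <= P)%N ->
  (forall m, 0 <= mu m) -> (forall l, 0 <= la l) ->
  (forall m, `|p1 m| <= X%:Z) -> (forall m, `|p2 m| <= X%:Z) ->
  (forall l, `|q1 l| <= X%:Z) -> (forall l, `|q2 l| <= X%:Z) ->
  (forall z1 z2 : int,
    \sum_(m | (`|p1 m - z1| < K%:Z) && (`|p2 m - z2| < K%:Z)) mu m <= Lmu) ->
  (forall z1 z2 : int,
    \sum_(l | (`|q1 l - z1| < K%:Z) && (`|q2 l - z2| < K%:Z)) la l <= Lla) ->
  \sum_l la l * sqn (\sum_m (mu m)%:C *
     (g m * ch (t%:Z * (p1 m * q1 l + p2 m * q2 l)))) <=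
  64 * (P%:R / (J%:R * K%:R)) ^+ 2 * (Lla * Lmu) * \sum_m mu m * sqn (g m).
Proof.
move=> K0 J0 JtK h16 h8 hJ mu0 la0 p1X p2X q1X q2X hmu hla.
have Kr : 0 < K%:R :> R by rewrite ltr0n.
have Jr : 0 < J%:R :> R by rewrite ltr0n.
have t0 : (0 < t)%N by nia.
have Lla0 : 0 <= Lla by apply: le_trans (hla 0 0); apply: sumr_ge0.
have Lmu0 : 0 <= Lmu by apply: le_trans (hmu 0 0); apply: sumr_ge0.
(* Averaging over the K * K shifts h multiplies the coefficient of m by D m,
   which no cancellation makes small; dividing by it writes the exponential sum
   at l as an average of a sum h' over the window of side K at l. *)
pose D m := \sum_(h : 'I_K * 'I_K) ch (t%:Z * (p1 m * h.1%:Z + p2 m * h.2%:Z)).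
have D_ge m : K%:R ^+ 4 / 4 <= sqn (D m).
  apply: (@le_trans _ _ ((#|{: 'I_K * 'I_K}|%:R / 2) ^+ 2)).
    by rewrite card_prod card_ord natrM le_eqVlt; apply/orP; left; apply/eqP; field.
  apply: (@sqn_sum_ch_ge R P P0 _
    (fun h : 'I_K * 'I_K => t%:Z * (p1 m * h.1%:Z + p2 m * h.2%:Z))) => -[h1 h2] /=.
  have hX (a : int) (h : 'I_K) : `|a| <= X%:Z -> `|a * h%:Z| <= X%:Z * K%:Z.
    by move=> aX; rewrite normrM ler_pM//; have := ltn_ord h; lia.
  rewrite normrM; apply: (@le_trans _ _ ((t%:Z * (2 * (X%:Z * K%:Z))) *+ 8)); last by lia.
  rewrite lerMn2r/= ler_pM//; have := hX _ h1 (p1X m); have := hX _ h2 (p2X m); lia.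
have D_gt m : 0 < sqn (D m) by apply: lt_le_trans (D_ge m); rewrite divr_gt0 ?exprn_gt0.
have D0 m : D m != 0.
  by apply: contraTneq (D_gt m) => ->; rewrite /sqn /= expr0n addr0 ltxx.
pose g' m := g m / D m.
have g'_le m : sqn (g' m) <= 4 / K%:R ^+ 4 * sqn (g m).
  rewrite /g' sqnM sqnV mulrC ler_wpM2r ?sqn_ge0//.
  by rewrite -[4 / _]invf_div lef_pV2 ?posrE ?divr_gt0 ?exprn_gt0.
pose h' (x y : int) := \sum_m (mu m)%:C * (g' m * ch (t%:Z * (p1 m * x + p2 m * y))).
(* F x has size about J on the relevant range, while multiplying h' by it turns
   the frequencies t p1, t p2 into intervals of length J. *)
pose F (x : int) := \sum_(j < J) ch (j%:Z * x).
have F_ge x : `|x| <= (X + K)%:Z -> J%:R ^+ 2 / 4 <= sqn (F x).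
  move=> hx; apply: (@le_trans _ _ ((#|'I_J|%:R / 2) ^+ 2)).
    by rewrite card_ord le_eqVlt; apply/orP; left; apply/eqP; field.
  apply: (@sqn_sum_ch_ge R P P0 _ (fun j : 'I_J => j%:Z * x)) => j.
  by rewrite normrM ger0_norm//; have := ltn_ord j; nia.
pose G x y := sqn (h' x y) * (sqn (F x) * sqn (F y)).
have GE x y : G x y = sqn (\sum_(a : M * ('I_J * 'I_J)) (mu a.1)%:C *
   (g' a.1 * ch ((t%:Z * p1 a.1 + a.2.1%:Z) * x + (t%:Z * p2 a.1 + a.2.2%:Z) * y))).
  rewrite /G -!sqnM; congr sqn; rewrite [F x * _]big_distrlr pair_big big_distrlr pair_big /=.
  apply: eq_bigr => -[m [j1 j2]] _ /=.
  by rewrite -!mulrA -!chD; do 3 congr (_ * _); congr (ch _); ring.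
have G0 x y : 0 <= G x y by rewrite /G !mulr_ge0 ?sqn_ge0.
have step1 l : sqn (\sum_m (mu m)%:C * (g m * ch (t%:Z * (p1 m * q1 l + p2 m * q2 l))))
   <= 16 * K%:R ^+ 2 / J%:R ^+ 4 *
      \sum_(h : 'I_K * 'I_K) G (q1 l + h.1%:Z) (q2 l + h.2%:Z).
  have -> : \sum_m (mu m)%:C * (g m * ch (t%:Z * (p1 m * q1 l + p2 m * q2 l))) =
     \sum_(h : 'I_K * 'I_K) (1 : R)%:C * h' (q1 l + h.1%:Z) (q2 l + h.2%:Z).
    under [RHS]eq_bigr do rewrite mul1r; rewrite exchange_big /=.
    apply: eq_bigr => m _; rewrite -mulr_sumr; congr (_ * _).
    transitivity (g' m * (D m * ch (t%:Z * (p1 m * q1 l + p2 m * q2 l)))).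
      by rewrite mulrA mulfVK.
    rewrite -mulr_sumr; congr (_ * _); rewrite /D mulr_suml.
    by apply: eq_bigr => h _; rewrite -chD; congr (ch _); ring.
  apply: le_trans (sqn_wsum_le _ _) _ => //.
  have -> : \sum_(h : 'I_K * 'I_K) (1 : R) = K%:R ^+ 2.
    by rewrite sumr_const card_prod card_ord natrM expr2.
  rewrite [16 * _]mulrC -[_ / _ * _]mulrA -[_ * 16 * _]mulrA ler_wpM2l ?exprn_ge0 ?ler0n//.
  rewrite mulrA mulr_sumr.
  apply: ler_sum => -[i1 i2] _ /=; rewrite mul1r /G mulrCA -[leLHS]mulr1 ler_wpM2l ?sqn_ge0//.
  have qX (q : int) (i : 'I_K) : `|q| <= X%:Z -> `|q + i%:Z| <= (X + K)%:Z.
    by have := ltn_ord i; lia.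
  rewrite [leLHS](_ : 1 = 16 / J%:R ^+ 4 * (J%:R ^+ 2 / 4 * (J%:R ^+ 2 / 4))); last first.
    by field; rewrite gt_eqF.
  rewrite ler_wpM2l ?divr_ge0 ?exprn_ge0 ?ler0n//.
  by rewrite ler_pM ?divr_ge0 ?exprn_ge0 ?ler0n// F_ge// qX.
(* Two of these intervals meet only for points at distance less than J / t <= K,
   so the ball masses control the off-diagonal terms. *)
have step2 : \sum_(v : 'I_P * 'I_P) G (v.1%:Z - X%:Z) (v.2%:Z - X%:Z) <=
    P%:R ^+ 2 * Lmu * (J%:R ^+ 2 * (4 / K%:R ^+ 4 * \sum_m mu m * sqn (g m))).
  under eq_bigr do rewrite GE.
  apply: le_trans (@large_sieve2 R P P0 _ (fun a : M * ('I_J * 'I_J) => t%:Z * p1 a.1 + a.2.1%:Z)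
    (fun a => t%:Z * p2 a.1 + a.2.2%:Z) (fun a => mu a.1) (fun a => g' a.1) Lmu X%:Z
    (fun a => mu0 a.1) _ _ _) _.
  - move=> [m [i1 i2]] [n [j1 j2]] /=.
    have := ltn_ord i1; have := ltn_ord j1; have := p1X m; have := p1X n.
    by move=> *; nia.
  - move=> [m [i1 i2]] [n [j1 j2]] /=.
    have := ltn_ord i2; have := ltn_ord j2; have := p2X m; have := p2X n.
    by move=> *; nia.
  - move=> [m [i1 i2]] /=; apply: le_trans (hmu (p1 m) (p2 m)).
    rewrite -(pair_big_dep xpredT (fun n (j : 'I_J * 'I_J) =>
       (t%:Z * p1 m + i1%:Z == t%:Z * p1 n + j.1%:Z) &&
       (t%:Z * p2 m + i2%:Z == t%:Z * p2 n + j.2%:Z)) (fun n _ => mu n)) /=.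
    rewrite [leRHS]big_mkcond; apply: ler_sum => n _.
    case: ifPn => hn.
      rewrite sumr_const -[leRHS]mulr1n ler_wpMn2l//.
      apply/card_le1_eqP => -[j1 j2] [k1 k2] jE kE.
      have {jE}/andP[/eqP j1E /eqP j2E] :
       (t%:Z * p1 m + i1%:Z == t%:Z * p1 n + j1%:Z) &&
       (t%:Z * p2 m + i2%:Z == t%:Z * p2 n + j2%:Z) by exact: jE.
      have {kE}/andP[/eqP k1E /eqP k2E] :
       (t%:Z * p1 m + i1%:Z == t%:Z * p1 n + k1%:Z) &&
       (t%:Z * p2 m + i2%:Z == t%:Z * p2 n + k2%:Z) by exact: kE.
      by congr pair; apply/val_inj => /=; lia.
    rewrite big_pred0// => -[j1 j2] /=; apply/negP => /andP[/eqP j1E /eqP j2E].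
    have := ltn_ord i1; have := ltn_ord i2; have := ltn_ord j1; have := ltn_ord j2.
    move=> ? ? ? ?; move/negP: hn; apply; apply/andP; split; nia.
  - rewrite ler_wpM2l ?mulr_ge0 ?exprn_ge0 ?ler0n//.
    rewrite -(pair_big xpredT xpredT (fun m (_ : 'I_J * 'I_J) => mu m * sqn (g' m))) /=.
    rewrite mulr_sumr mulr_sumr; apply: ler_sum => m _.
    rewrite sumr_const card_prod card_ord -[leLHS]mulr_natl natrM -expr2.
    by rewrite ler_wpM2l ?exprn_ge0 ?ler0n// mulrCA ler_wpM2l.
have step3 : \sum_l la l * \sum_(h : 'I_K * 'I_K) G (q1 l + h.1%:Z) (q2 l + h.2%:Z) <=
    Lla * \sum_(v : 'I_P * 'I_P) G (v.1%:Z - X%:Z) (v.2%:Z - X%:Z).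
  by apply: window_sum_le => //; nia.
apply: (@le_trans _ _ (16 * K%:R ^+ 2 / J%:R ^+ 4 * (Lla *
   (P%:R ^+ 2 * Lmu * (J%:R ^+ 2 * (4 / K%:R ^+ 4 * \sum_m mu m * sqn (g m))))))); last first.
  rewrite le_eqVlt; apply/orP; left; apply/eqP; field.
  by rewrite !gt_eqF.
apply: (@le_trans _ _ (16 * K%:R ^+ 2 / J%:R ^+ 4 *
   \sum_l la l * \sum_(h : 'I_K * 'I_K) G (q1 l + h.1%:Z) (q2 l + h.2%:Z))).
  by rewrite mulr_sumr; apply: ler_sum => l _; rewrite mulrCA ler_wpM2l.
have c0 : 0 <= 16 * K%:R ^+ 2 / J%:R ^+ 4 :> R.
  by rewrite !mulr_ge0 ?invr_ge0 ?exprn_ge0 ?ler0n.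
rewrite ler_wpM2l//; apply: le_trans step3 _; exact: ler_wpM2l.
Qed.
End double_sieve.

(** * The energy of the product set *)

(** The interval around c splits into 2 A intervals of length K, each inside a
    K-ball around its left end. *)
Lemma cover_sum_le (R : realType) (L : finType) (nu : L -> R) (S : pred L)
    (f : L -> int) (c : int) (K A : nat) (La : R) :
  (0 < K)%N -> (forall l, 0 <= nu l) ->
  (forall l, S l -> `|f l - c| < (A * K)%:Z) ->
  (forall z : int, \sum_(l | S l && (`|f l - z| < K%:Z)) nu l <= La) ->
  \sum_(l | S l) nu l <= (2 * A)%:R * La.
Proof.
move=> K0 nu0 hS hLa.
pose z (i : 'I_(2 * A)) : int := c + (i%:Z - A%:Z) * K%:Z.
apply: (@le_trans _ _ (\sum_(i < 2 * A) \sum_(l | S l && (`|f l - z i| < K%:Z)) nu l)).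
  rewrite (exchange_big_dep S)/=; last by move=> i l _ /andP[].
  apply: ler_sum => l Sl; rewrite sumr_const -[leLHS]mulr1n ler_wpMn2l//.
  have hl := hS _ Sl.
  pose d := absz (f l - c + (A * K)%:Z)%R.
  have dE : d%:Z = f l - c + (A * K)%:Z by rewrite /d; lia.
  have dlt : (d %/ K < 2 * A)%N by rewrite ltn_divLR//; nia.
  apply/card_gt0P; exists (Ordinal dlt); rewrite unfold_in Sl /z /=.
  have := divn_eq d K; have := ltn_pmod d K0.
  move: (d %/ K)%N (d %% K)%N => x y hy hx.
  have -> : f l - (c + (x%:Z - A%:Z) * K%:Z) = y%:Z by nia.
  lia.
apply: (@le_trans _ _ (\sum_(i < 2 * A) La)); first exact: ler_sum.
by rewrite sumr_const card_ord mulr_natl.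
Qed.

(** When p2 is at most a bounded multiple of p1, a strip orthogonal to (p1, p2)
    crosses O(T) rows of height K, and the part in one row is covered by O(1) balls
    of radius K. *)
Lemma strip_le (R : realType) (L : finType) (nu : L -> R) (q1 q2 : L -> int)
    (p1 p2 c : int) (B rho T K : nat) (La : R) :
  (0 < K)%N -> (0 < T)%N -> (forall l, 0 <= nu l) ->
  (forall l, `|q2 l| <= (B * (T * K))%:Z) ->
  `|p2| <= (B * (T * K))%:Z -> (T * K)%:Z <= rho%:Z * `|p1| ->
  (forall z1 z2 : int,
    \sum_(l | (`|q1 l - z1| < K%:Z) && (`|q2 l - z2| < K%:Z)) nu l <= La) ->
  \sum_(l | `|p1 * q1 l + p2 * q2 l - c| < (T * K * K)%:Z) nu l <=
  (8 * rho * B.+1 ^ 2 * T)%:R * La.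
Proof.
move=> K0 T0 nu0 q2X p2X p1X hLa.
have La0 : 0 <= La by apply: le_trans (hLa 0 0); apply: sumr_ge0.
apply: (@le_trans _ _ ((2 * (B * T + 1))%:R * ((2 * (rho * (2 * B + 2)))%:R * La))); last first.
  by rewrite mulrA -natrM ler_wpM2r// ler_nat; nia.
apply: (@cover_sum_le _ _ _ _ q2 0 K) => //.
  by move=> l _; rewrite subr0; apply: le_lt_trans (q2X l) _; nia.
move=> z.
(* Inside one row, any two points of the strip are close in the first coordinate. *)
set S := fun l => (`|p1 * q1 l + p2 * q2 l - c| < (T * K * K)%:Z) && (`|q2 l - z| < K%:Z).
have [l0 Sl0|S0] := pickP S; last first.
  by rewrite big_pred0// mulr_ge0.
apply: (@cover_sum_le _ _ _ S q1 (q1 l0) K) => //.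
  move=> l /andP[h1 h2]; case/andP: Sl0 => [h3 h4].
  have h5 : `|p1 * (q1 l - q1 l0)| < ((2 * B + 2) * (T * K * K))%:Z.
    have h6 : `|p2 * (q2 l - q2 l0)| <= ((B * (T * K)) * (2 * K))%:Z.
      rewrite normrM PoszM ler_pM//; lia.
    lia.
  rewrite normrM in h5; move: h5 p1X.
  move: `|p1| `|q1 l - q1 l0| (normr_ge0 p1) (normr_ge0 (q1 l - q1 l0)) => a b a0 b0 h5 h6.
  have N0 : 0 < (T * K)%:Z by nia.
  have rho0 : 0 < rho%:Z by case: (rho) h6 => // h6; nia.
  rewrite -(ltr_pM2l N0); apply: (@le_lt_trans _ _ (rho%:Z * (a * b))); first by nia.
  apply: (@lt_le_trans _ _ (rho%:Z * ((2 * B + 2) * (T * K * K))%:Z)); last by lia.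
  by rewrite ltr_pM2l.
move=> z1; apply: le_trans (hLa z1 z).
rewrite big_mkcond [leRHS]big_mkcond; apply: ler_sum => l _; rewrite /S.
by case: ifP => [/andP[/andP[_ ->] ->]|_]//; case: ifP.
Qed.

Lemma sum_dist_le (R : realType) (phi : nat -> R) (N : nat) :
  (forall n, 0 <= phi n) ->
  \sum_(t < N) \sum_(u < N) phi `|t%:Z - u%:Z|%N <= (2 * N)%:R * \sum_(t < N) phi t.
Proof.
move=> phi0.
apply: (@le_trans _ _ (\sum_(t < N) (2 * \sum_(u < N) phi u))); last first.
  by rewrite sumr_const card_ord -[leLHS]mulr_natl natrM mulrA [2 * _]mulrC lexx.
apply: ler_sum => t _.
pose e (u : 'I_N) := `|t%:Z - u%:Z|%N.
have eN u : (e u < N)%N by rewrite /e; have := ltn_ord u; have := ltn_ord t; lia.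
rewrite (partition_big (fun u => Ordinal (eN u)) xpredT)//= mulr_sumr.
apply: ler_sum => d _.
apply: (@le_trans _ _ (\sum_(u < N | Ordinal (eN u) == d) phi d)).
  by apply: ler_sum => u /eqP <-.
rewrite sumr_const -[leLHS]mulr_natl ler_wpM2r// (ler_nat _ _ 2).
(* A given distance to t is reached at most once on each side. *)
pose D1 := [set x : 'I_N | x == t - d :> nat]%N.
pose D2 := [set x : 'I_N | x == t + d :> nat]%N.
apply: (@leq_trans #|D1 :|: D2|).
  apply: subset_leq_card; apply/fintype.subsetP => u; rewrite unfold_in !inE => ud.
  have : e u = d by move/eqP: ud => <-.
  by rewrite /e => h; apply/orP; case: (leqP u t) => ?; [left|right]; lia.
apply: (leq_trans (leq_card_setU _ _)).
apply: (@leq_trans (1 + 1)%N) => //; apply: leq_add; apply/card_le1_eqP => x y;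
  rewrite !inE => /eqP hx /eqP hy; apply/val_inj; rewrite /= hx hy; reflexivity.
Qed.

Lemma sum_dyadic_le (R : realType) (phi : nat -> R) (D x : R) (k : nat) :
  0 <= D -> 0 <= x -> x < 1 ->
  (forall j, (j < k)%N -> \sum_(2 ^ j <= t < 2 ^ j.+1) phi t <= D * x ^+ j) ->
  \sum_(0 <= t < 2 ^ k) phi t <= phi 0 + D / (1 - x).
Proof.
move=> D0 x0 x1 h.
have h1 : \sum_(0 <= t < 2 ^ k) phi t <= phi 0 + D * \sum_(j < k) x ^+ j.
  elim: k h => [|k IH] h.
    by rewrite big_nat1 big_ord0 mulr0 addr0.
  rewrite (big_cat_nat (n := 2 ^ k))//=; last by rewrite leq_exp2l.
  rewrite big_ord_recr/= mulrDr addrA lerD//; last exact: h.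
  by apply: IH => j jk; apply: h; apply: ltnW.
apply: le_trans h1 _; rewrite lerD2l ler_wpM2l//.
rewrite -[leRHS]mul1r ler_pdivlMr ?subr_gt0// mulrC.
by rewrite -opprB mulNr -subrX1 opprB gerBl exprn_ge0.
Qed.

(** The s-dimensional Frostman condition down to scale 2^-k, on a grid of mesh
    2^-k, with al = 2^-s. *)
Definition ball_bound (R : realType) (M : finType) (mu : M -> R) (p1 p2 : M -> int)
    (k : nat) (C al : R) :=
  forall (j : nat) (z1 z2 : int), (j <= k)%N ->
    \sum_(m | (`|p1 m - z1| < (2 ^ (k - j))%:Z) && (`|p2 m - z2| < (2 ^ (k - j))%:Z)) mu m
    <= C * al ^+ j.

Section energy.
Local Open Scope complex_scope.
Context (R : realType) (B rho k : nat) (C al be ga : R).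
Context (M L H : finType) (mu : M -> R) (nu : L -> R) (la : H -> R).
Context (p1 p2 : M -> int) (q1 q2 : L -> int) (r1 r2 : H -> int).
Hypotheses (C0 : 0 <= C) (al0 : 0 <= al) (be0 : 0 <= be) (ga0 : 0 <= ga).
Hypotheses (mu0 : forall m, 0 <= mu m) (nu0 : forall l, 0 <= nu l)
  (la0 : forall h, 0 <= la h).
Hypotheses (muC : \sum_m mu m <= C) (nuC : \sum_l nu l <= C) (laC : \sum_h la h <= C).
Hypotheses (p1X : forall m, `|p1 m| <= (B * 2 ^ k)%:Z)
  (p2X : forall m, `|p2 m| <= (B * 2 ^ k)%:Z)
  (q1X : forall l, `|q1 l| <= (B * 2 ^ k)%:Z)
  (q2X : forall l, `|q2 l| <= (B * 2 ^ k)%:Z)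
  (r1X : forall h, `|r1 h| <= (B * 2 ^ k)%:Z)
  (r2X : forall h, `|r2 h| <= (B * 2 ^ k)%:Z).
Hypothesis far : forall m, mu m != 0 ->
  ((2 ^ k)%:Z <= rho%:Z * `|p1 m|) || ((2 ^ k)%:Z <= rho%:Z * `|p2 m|).
Hypotheses (mu_ball : ball_bound mu p1 p2 k C al)
  (nu_ball : ball_bound nu q1 q2 k C be) (la_ball : ball_bound la r1 r2 k C ga).

Let N := (2 ^ k)%N.
(* Large enough that the integers compared below, all of size O(B ^ 2 N ^ 2),
   stay smaller than P and never wrap around. *)
Let Q := (32 * B ^ 2 + 16)%N.
Let P := (Q * N ^ 2)%N.
Local Notation ch := (@ch R P).

Let N0 : (0 < N)%N. Proof. by rewrite expn_gt0. Qed.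
Let P0 : (0 < P)%N. Proof. by rewrite muln_gt0 expn_gt0 N0 /Q addnS. Qed.

Let le_P (c n : nat) : (c <= 32 * B ^ 2 + 16)%N -> (n <= c * N ^ 2)%N -> (n <= P)%N.
Proof. by move=> cQ nc; apply: leq_trans nc _; rewrite /P leq_mul2r cQ orbT. Qed.

Let BB : (B <= B ^ 2)%N.
Proof. by case: (B) => // b; rewrite -{1}(expn1 b.+1) leq_pexp2l. Qed.

Let NN : (N <= N ^ 2)%N.
Proof. by rewrite -{1}(expn1 N) leq_pexp2l. Qed.

Let w (a : M * L * H) := mu a.1.1 * nu a.1.2 * la a.2.
Let s (a : M * L * H) : int :=
  p1 a.1.1 * (q1 a.1.2 + r1 a.2) + p2 a.1.1 * (q2 a.1.2 + r2 a.2).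
Let eta (t : int) := \sum_a (w a)%:C * ch (t * s a).
Let g (t : int) (m : M) := \sum_l (nu l)%:C * ch (t * (p1 m * q1 l + p2 m * q2 l)).

Let w0 a : 0 <= w a. Proof. by rewrite /w !mulr_ge0. Qed.

(** Summing over y first shows eta as a bilinear form in x and z with
    coefficients g t. *)
Lemma etaE t : eta t = \sum_h (la h)%:C *
  \sum_m (mu m)%:C * (g t m * ch (t * (p1 m * r1 h + p2 m * r2 h))).
Proof.
have -> : eta t = \sum_m \sum_l \sum_h
   ((mu m)%:C * (nu l)%:C * (la h)%:C * ch (t * s (m, l, h))).
  rewrite pair_big pair_big /=; apply: eq_bigr => -[[m l] h] _ /=.
  by rewrite /w /= !rmorphM.
under eq_bigr do rewrite exchange_big; rewrite exchange_big.
apply: eq_bigr => h _; rewrite mulr_sumr; apply: eq_bigr => m _.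
rewrite mulrA mulrA /g mulr_sumr mulr_suml; apply: eq_bigr => l _.
have -> : ch (t * s (m, l, h)) = ch (t * (p1 m * q1 l + p2 m * q2 l)) *
    ch (t * (p1 m * r1 h + p2 m * r2 h)).
  by rewrite -chD; congr (ch _); rewrite /s /=; ring.
ring.
Qed.

Section one_scale.
Context (j : nat) (jk : (j < k)%N).
Let T := (2 ^ j)%N.
Let K := (2 ^ (k - j))%N.
Let TK : (T * K = N)%N. Proof. by rewrite /T /K -expnD subnKC// ltnW. Qed.
Let T0 : (0 < T)%N. Proof. by rewrite expn_gt0. Qed.
Let K0 : (0 < K)%N. Proof. by rewrite expn_gt0. Qed.
Let K2 : (2 <= K)%N.
Proof. by rewrite /K -{1}(expn1 2) leq_exp2l// subn_gt0. Qed.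

Lemma PNK : P%:R / (N%:R * K%:R) = Q%:R * T%:R :> R.
Proof.
rewrite /P -TK !(natrM, natrX); field.
by rewrite !expf_neq0 ?pnatr_eq0.
Qed.

(** Cauchy-Schwarz in z followed by [double_large_sieve] with J = N and
    K = N / T. *)
Lemma sqn_eta_le (t : nat) : (T <= t < 2 * T)%N ->
  sqn (eta t) <= 64 * C ^+ 3 * (Q%:R * T%:R) ^+ 2 * (al * ga) ^+ j *
     \sum_m mu m * sqn (g t m).
Proof.
move=> /andP[Tt t2T]; rewrite etaE.
apply: le_trans (sqn_wsum_le _ la0) _.
have X0 : (16 * t * (B * N) * K <= P)%N.
  apply: (@le_P (32 * B)); first by lia.
  apply: (@leq_trans (16 * (2 * T) * (B * N) * K)%N); first by rewrite !leq_mul// ltnW.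
  by rewrite (_ : 16 * (2 * T) * (B * N) * K = 32 * B * (N * (T * K)))%N; [rewrite TK mulnn | ring].
have KN : (K <= N)%N by rewrite -TK leq_pmull.
have TN : (2 * T <= N)%N by rewrite -TK mulnC leq_mul.
have X1 : (8 * N * (B * N + K) <= P)%N.
  apply: (@le_P (8 * B + 8)); first by lia.
  apply: (@leq_trans (8 * N * (B * N + N))%N); first by rewrite leq_mul// leq_add2l.
  by rewrite (_ : 8 * N * (B * N + N) = (8 * B + 8) * N ^ 2)%N; [ | ring].
have X2 : (N + 2 * t * (B * N) <= P)%N.
  apply: (@le_P (2 * B + 1)); first by lia.
  apply: (@leq_trans (N ^ 2 + 2 * N * (B * N))%N).
    by rewrite leq_add// leq_mul// leq_mul// (leq_trans (ltnW t2T)).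
  by rewrite (_ : N ^ 2 + 2 * N * (B * N) = (2 * B + 1) * N ^ 2)%N; [ | ring].
have NtK : (N <= t * K)%N by rewrite -TK leq_mul.
have dl := double_large_sieve P0 (g t) K0 N0 NtK X0 X1 X2 mu0 la0 p1X p2X r1X r2X
   (fun z1 z2 => mu_ball z1 z2 (ltnW jk)) (fun z1 z2 => la_ball z1 z2 (ltnW jk)).
apply: (@le_trans _ _ (C * (64 * (Q%:R * T%:R) ^+ 2 * (C * ga ^+ j * (C * al ^+ j)) *
   \sum_m mu m * sqn (g t m)))); last first.
  by rewrite [(al * ga) ^+ j]exprMn le_eqVlt; apply/orP; left; apply/eqP; ring.
rewrite -PNK; apply: ler_pM => //; first exact: sumr_ge0.
by apply: sumr_ge0 => h _; rewrite mulr_ge0// sqn_ge0.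
Qed.

Let Cs := (8 * rho * B.+1 ^ 2)%N.

(** [time_sieve] with J = N K reduces to the nu-mass of a strip orthogonal to the
    point m, which is far enough from the origin for [strip_le]. *)
Lemma sum_sqn_g_le (m : M) : mu m != 0 ->
  \sum_(t < 2 * T) sqn (g t m) <= 4 * (Q%:R * T%:R) * (Cs%:R * T%:R * (C * be ^+ j)) * C.
Proof.
move=> mm.
have X1 : (8 * (N * K) * (2 * T) <= P)%N.
  apply: (@le_P 16); first by lia.
  by rewrite (_ : 8 * (N * K) * (2 * T) = 16 * (N * (T * K)))%N; [rewrite TK mulnn | ring].
have KN : (K <= N)%N by rewrite -TK leq_pmull.
have X2 : (N * K + 2 * (2 * B ^ 2 * N ^ 2) <= P)%N.
  apply: (@le_P (4 * B ^ 2 + 1)); first by lia.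
  apply: (@leq_trans (N * N + 2 * (2 * B ^ 2 * N ^ 2))%N).
    by rewrite leq_add2r leq_mul.
  by rewrite (_ : N * N + 2 * (2 * B ^ 2 * N ^ 2) = (4 * B ^ 2 + 1) * N ^ 2)%N; [ | ring].
have La0 : 0 <= Cs%:R * T%:R * (C * be ^+ j).
  by rewrite !mulr_ge0 ?exprn_ge0 ?ler0n.
have NK0 : (0 < N * K)%N by rewrite muln_gt0 N0.
have sX l : `|p1 m * q1 l + p2 m * q2 l| <= (2 * B ^ 2 * N ^ 2)%:Z.
  apply: le_trans (ler_normD _ _) _; rewrite !normrM.
  apply: (@le_trans _ _ ((B * N)%:Z * (B * N)%:Z + (B * N)%:Z * (B * N)%:Z)); last first.
    rewrite -PoszM -PoszD lez_nat.
    by rewrite (_ : 2 * B ^ 2 * N ^ 2 = B * N * (B * N) + B * N * (B * N))%N//; ring.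
  by apply: lerD; apply: ler_pM.
have strip l : \sum_(n | `|p1 m * q1 n + p2 m * q2 n - (p1 m * q1 l + p2 m * q2 l)|
    < (N * K)%:Z) nu n <= Cs%:R * T%:R * (C * be ^+ j).
  rewrite -natrM -TK; case/orP: (far mm) => fm.
    apply: (@strip_le _ _ nu q1 q2 (p1 m) (p2 m)) => //; rewrite ?TK//.
    by move=> z1 z2; apply: nu_ball; apply: ltnW.
  under eq_bigl do rewrite [p1 m * _ + _]addrC.
  apply: (@strip_le _ _ nu q2 q1 (p2 m) (p1 m)) => //; rewrite ?TK//.
  move=> z1 z2; under eq_bigl do rewrite andbC.
  by apply: nu_ball; apply: ltnW.
apply: le_trans (time_sieve P0 NK0 X1 X2 La0 nu0 sX strip) _.
by rewrite natrM PNK ler_wpM2l// mulr_ge0// mulr_ge0// mulr_ge0 ?ler0n.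
Qed.

Lemma sum_sqn_eta_le : \sum_(T <= t < 2 ^ j.+1) sqn (eta t) <=
  256 * C ^+ 6 * Q%:R ^+ 3 * Cs%:R * (16 * (al * be * ga)) ^+ j.
Proof.
rewrite expnS -/T.
set D := 64 * C ^+ 3 * (Q%:R * T%:R) ^+ 2 * (al * ga) ^+ j.
have D0 : 0 <= D by rewrite /D !mulr_ge0 ?exprn_ge0 ?mulr_ge0 ?ler0n.
apply: (@le_trans _ _ (\sum_(T <= t < 2 * T) D * \sum_m mu m * sqn (g t m))).
  by apply: ler_sum_nat => t tT; apply: sqn_eta_le.
rewrite -mulr_sumr exchange_big /=.
set D2 := 4 * (Q%:R * T%:R) * (Cs%:R * T%:R * (C * be ^+ j)) * C.
have D20 : 0 <= D2 by rewrite /D2 !mulr_ge0 ?exprn_ge0 ?ler0n.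
apply: (@le_trans _ _ (D * (C * D2))).
  rewrite ler_wpM2l//; apply: (@le_trans _ _ (\sum_m mu m * D2)); last first.
    by rewrite -mulr_suml ler_wpM2r.
  apply: ler_sum => m _; have [->|mm] := eqVneq (mu m) 0.
    by rewrite mul0r big1// => t _; rewrite mul0r.
  rewrite -mulr_sumr ler_wpM2l//; apply: le_trans (sum_sqn_g_le mm).
  rewrite -(big_mkord xpredT (fun t => sqn (g t%:Z m))) /=.
  rewrite [leRHS](big_cat_nat (n := T))//= ?lerDr ?sumr_ge0// ?leq_pmull// => *.
  exact: sqn_ge0.
have T4 : 16 ^+ j = T%:R ^+ 4 :> R.
  by rewrite /T natrX -exprM mulnC exprM; congr (_ ^+ _); rewrite -natrX.
rewrite [(16 * _) ^+ j]exprMn T4 /D /D2 !exprMn.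
by rewrite le_eqVlt; apply/orP; left; apply/eqP; ring.
Qed.

End one_scale.

(** The factor 1 / N is what a bounded density would give; the constant in front
    does not depend on k. *)
Lemma energy_le : 16 * (al * be * ga) < 1 ->
  \sum_a \sum_(b | `|s a - s b| < N%:Z) w a * w b <=
  8 * (C ^+ 6 + 256 * C ^+ 6 * Q%:R ^+ 3 * (8 * rho * B.+1 ^ 2)%:R /
         (1 - 16 * (al * be * ga))) / N%:R.
Proof.
move=> x1.
have X1 : (8 * N * N <= P)%N.
  apply: (@le_P 8); first by lia.
  by rewrite -mulnA mulnn.
apply: le_trans (coincidence_le P0 s N0 X1 w0) _.
have etaN t : sqn (eta (- t)) = sqn (eta t).
  rewrite -sqn_cj /eta cj_sum; congr sqn; apply: eq_bigr => a _.
  by rewrite cjZ cj_ch mulNr opprK.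
have etaA (t u : nat) : sqn (\sum_a (w a)%:C * ch ((t%:Z - u%:Z) * s a)) =
   (fun d : nat => sqn (eta d)) `|t%:Z - u%:Z|%N.
  rewrite -/(eta _) /=; have [h|h] := lerP 0 (t%:Z - u%:Z).
    by congr (sqn (eta _)); lia.
  by rewrite -etaN; congr (sqn (eta _)); lia.
under eq_bigr do under eq_bigr do rewrite etaA.
have sd := @sum_dist_le R (fun d : nat => sqn (eta d)) N (fun=> sqn_ge0 _).
have eta0 : sqn (eta 0) <= C ^+ 6.
  have -> : eta 0 = (\sum_a w a)%:C.
    rewrite /eta rmorph_sum; apply: eq_bigr => a _; by rewrite mul0r ch0 mulr1.
  have -> : \sum_a w a = (\sum_m mu m) * (\sum_l nu l) * (\sum_h la h).
    by rewrite big_distrlr /= pair_big big_distrlr /= pair_big.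
  rewrite sqnC (_ : 6 = 3 * 2)%N// exprM ler_sqr ?nnegrE ?mulr_ge0 ?exprn_ge0 ?sumr_ge0//.
  rewrite exprS expr2 mulrA.
  by rewrite !ler_pM ?mulr_ge0 ?sumr_ge0.
have x0 : 0 <= 16 * (al * be * ga) by rewrite !mulr_ge0.
have S := @sum_dyadic_le R (fun d : nat => sqn (eta d)) _ _ k
   _ x0 x1 sum_sqn_eta_le.
have {}S := S ltac:(by rewrite !mulr_ge0 ?exprn_ge0 ?ler0n).
rewrite big_mkord in S.
have Nr : 0 < N%:R :> R by rewrite ltr0n.
apply: (@le_trans _ _ (4 / N%:R ^+ 2 * ((2 * N)%:R * \sum_(t < N) sqn (eta t)))).
  by rewrite ler_wpM2l// divr_ge0// exprn_ge0// ler0n.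
rewrite [leLHS](_ : _ = 8 * (\sum_(t < N) sqn (eta t)) / N%:R); last first.
  by rewrite natrM; field; rewrite gt_eqF.
rewrite ler_pM2r ?invr_gt0// ler_pM2l//; apply: le_trans S _.
by rewrite lerD2r.
Qed.

End energy.

(** * Frostman weights on a tree *)

(** Counterpart of [partition_big] for keys in a type that need not be finite. *)
Lemma sum_by_key (V : nmodType) (I : finType) (T : eqType) (key : I -> T) (F : I -> V) :
  \sum_u F u = \sum_(c <- undup [seq key u | u <- enum I]) \sum_(u | key u == c) F u.
Proof.
rewrite (exchange_big_dep xpredT)//=; apply: eq_bigr => u _.
rewrite -big_filter (_ : [seq _ <- _ | _] = [:: key u]) ?big_seq1//.
have : key u \in undup [seq key v | v <- enum I].
  by rewrite mem_undup; apply: map_f; rewrite mem_enum.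
move: (undup_uniq [seq key v | v <- enum I]) => us /(filter_pred1_uniq us) <-.
by apply: eq_filter => c; exact: (eq_sym (key u) c).
Qed.

Section frostman.
Context (R : realFieldType) (I : finType) (T : eqType) (blk : nat -> I -> T)
  (K : nat) (cost : nat -> R).
Hypothesis cost0 : forall j, 0 < cost j.
Hypothesis blk_coarse : forall j u v, (j < K)%N ->
  blk j.+1 u = blk j.+1 v -> blk j u = blk j v.
Hypothesis blk_inj : injective (blk K).

Let blk_le i j u v : (i <= j)%N -> (j <= K)%N -> blk j u = blk j v -> blk i u = blk i v.
Proof.
move=> ij jK; elim: j ij jK => [|j IH]; first by rewrite leqn0 => /eqP ->.
rewrite leq_eqVlt => /orP[/eqP -> //|ij] jK h.
by apply: IH => //; [exact: ltnW | exact: blk_coarse].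
Qed.

Let mass (w : I -> R) j u := \sum_(v | blk j v == blk j u) w v.

(** The weights respect the costs on all levels from j on, and every point u lies
    in a block, the one of level lev u, on which equality holds; the last clause
    makes these blocks disjoint. *)
Let saturated j (w : I -> R) (lev : I -> nat) :=
  [/\ forall u, 0 <= w u,
      forall i u, (j <= i <= K)%N -> mass w i u <= cost i,
      forall u, (j <= lev u <= K)%N,
      forall u, mass w (lev u) u = cost (lev u) &
      forall u v, blk (lev u) v = blk (lev u) u -> lev v = lev u].

Lemma saturated_exists j : (j <= K)%N -> exists w lev, saturated j w lev.
Proof.
move=> jK; rewrite -(subKn jK); elim: (K - j)%N (leq_subr j K) => [|n IH] nK.
  have m u : mass (fun=> cost K) K u = cost K.
    rewrite /mass (big_pred1 u)// => v; apply/eqP/eqP => [|->//].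
    exact: blk_inj.
  rewrite subn0; exists (fun=> cost K), (fun=> K); split=> //.
  - by move=> u; apply: ltW.
  - by move=> i u; rewrite -eqn_leq => /eqP <-; rewrite m.
  - by move=> u; rewrite leqnn.
have [|w [lev [w0 wle levj levm levb]]] := IH; first exact: ltnW.
(* Blocks of level i that carry too much are scaled down to their cost and become
   the new saturated blocks of their points; the others are left alone. *)
set i := (K - n.+1)%N; have iE : (K - n = i.+1)%N by rewrite /i; lia.
rewrite iE in wle levj; have iK : (i < K)%N by rewrite /i; lia.
have massE u v : blk i u = blk i v -> mass w i u = mass w i v.
  by move=> e; rewrite /mass e.
pose w' u := if mass w i u > cost i then w u * (cost i / mass w i u) else w u.
pose lev' u := if mass w i u > cost i then i else lev u.
have w'0 u : 0 <= w' u.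
  rewrite /w'; case: ifPn => // h.
  by rewrite mulr_ge0// divr_ge0 ?ltW// (lt_trans (cost0 i)).
have w'w u : w' u <= w u.
  rewrite /w'; case: ifPn => // h.
  by rewrite ler_piMr// ler_pdivrMr ?mul1r ?(ltW h)// (lt_trans (cost0 i)).
have big u : mass w i u > cost i -> mass w' i u = cost i.
  move=> h; rewrite /mass (eq_bigr (fun v => w v * (cost i / mass w i u))).
    by rewrite -mulr_suml -/(mass w i u) mulrC divfK// gt_eqF// (lt_trans (cost0 i)).
  by move=> v /eqP vu; rewrite /w' (massE _ _ vu) h.
have small u v : ~~ (mass w i u > cost i) -> blk i v = blk i u -> w' v = w v.
  by move=> h vu; rewrite /w' (massE _ _ vu) (negPf h).
exists w', lev'; split=> //.
- move=> l u /andP[il lK]; move: il; rewrite leq_eqVlt => /orP[/eqP <-|il]; last first.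
    apply: le_trans (wle l u _); last by rewrite il.
    by apply: ler_sum.
  have [h|h] := boolP (mass w i u > cost i); first by rewrite big.
  apply: (@le_trans _ _ (mass w i u)); first exact: ler_sum.
  by rewrite leNgt.
- move=> u; rewrite /lev'; case: ifPn => _; first by rewrite leqnn ltnW.
  by have /andP[h ->] := levj u; rewrite ltnW.
- move=> u; rewrite /lev'; case: ifPn => h; first exact: big.
  rewrite -levm; apply: eq_bigr => v /eqP vu; apply: small h _.
  by have /andP[h1 h2] := levj u; apply: blk_le vu => //; apply: ltnW.
- move=> u v; rewrite /lev'; case: ifPn => h vu; first by rewrite (massE _ _ vu) h.
  have /andP[h1 h2] := levj u.
  by rewrite (massE _ u) ?(negPf h) ?(levb _ _ vu)//; apply: blk_le vu => //; apply: ltnW.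
Qed.

(** Max-flow min-cut on a tree. Processing levels from fine to coarse, weights are
    scaled down whenever a block exceeds its cost; the saturated blocks that remain
    at the end are disjoint, cover everything, and carry exactly their cost. *)
Lemma frostman_tree : exists (w : I -> R) (lev : I -> nat),
  [/\ forall u, 0 <= w u,
      forall j u, (j <= K)%N -> \sum_(v | blk j v == blk j u) w v <= cost j,
      forall u, (lev u <= K)%N &
      \sum_(c <- undup [seq (lev u, blk (lev u) u) | u <- enum I]) cost c.1
        <= \sum_u w u].
Proof.
have [w [lev [w0 wle levj levm levb]]] := saturated_exists (leq0n K).
exists w, lev; split=> //.
set key := fun u => (lev u, blk (lev u) u).
rewrite (sum_by_key key).
rewrite !big_seq; apply: ler_sum => c; rewrite mem_undup => /mapP[u _ ->] /=.
rewrite -levm /mass le_eqVlt; apply/orP; left; apply/eqP; apply: eq_bigl => v.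
apply/eqP/eqP => [vu|]; first by rewrite /key (levb _ _ vu) vu.
by case=> -> ->.
Qed.

End frostman.

(** * Hausdorff dimension in the plane *)

Local Open Scope classical_set_scope.

Lemma exists_div_pow2_lt (R : realType) (c e : R) : 0 < e ->
  exists n0 : nat, forall n, (n0 <= n)%N -> c / (2 ^ n)%:R < e.
Proof.
move=> e0; exists (Num.truncn (c / e)).+1 => n hn.
rewrite ltr_pdivrMr ?ltr0n ?expn_gt0// mulrC -ltr_pdivrMr//.
apply: lt_le_trans (truncnS_gt _) _; rewrite ler_nat.
by apply: leq_trans hn (ltnW (ltn_expl _ _)).
Qed.

Lemma exists_exp_le (R : realType) (x e : R) : 0 <= x -> x < 1 -> 0 < e -> exists r, x ^+ r <= e.
Proof.
move=> x0 x1 e0; have : (fun n => x ^+ n) @ \oo --> (0 : R).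
  by apply: cvg_expr; rewrite ger0_norm.
move=> /cvgrPdist_lt /(_ e e0)[n _ hn]; exists n.
have := hn n (leqnn n); rewrite /= sub0r normrN ger0_norm ?exprn_ge0//.
exact: ltW.
Qed.

Lemma pow2N_lt1 (R : realType) (s : R) : 0 < s -> 2 `^ (- s) < 1.
Proof.
move=> s0; rewrite powRN invf_lt1 ?powR_gt0//.
have h : 1 `^ s = 1 :> R by rewrite powR1.
by rewrite -[ltLHS]h; apply: gt0_ltr_powR; rewrite ?nnegrE ?ltr1n.
Qed.

Section hausdorff.
Context (R : realType).
Implicit Types (x y : 'rV[R]_2) (E U : set 'rV[R]_2).

Local Notation i0 := (ord0 : 'I_2).
Local Notation i1 := (ord_max : 'I_2).

Lemma dotv2 x y : dotv x y = x ord0 i0 * y ord0 i0 + x ord0 i1 * y ord0 i1.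
Proof.
rewrite /dotv big_ord_recr big_ord_recr big_ord0 /= add0r.
by congr (x _ _ * y _ _ + _); apply/val_inj.
Qed.

Lemma enorm_ge0 x : 0 <= enorm x. Proof. exact: sqrtr_ge0. Qed.

Lemma enorm_le x : enorm x <= `|x ord0 i0| + `|x ord0 i1|.
Proof.
rewrite /enorm -[leRHS]ger0_norm ?addr_ge0// -sqrtr_sqr ler_wsqrtr// dotv2.
rewrite -!expr2 -(real_normK (num_real (x ord0 i0))) -(real_normK (num_real (x ord0 i1))).
by rewrite sqrrD lerD2r lerDl mulrn_wge0 ?mulr_ge0.
Qed.

Lemma coord_le_enorm x i : `|x ord0 i| <= enorm x.
Proof.
rewrite -sqrtr_sqr /enorm ler_wsqrtr// /dotv (bigD1 i)//= expr2 lerDl.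
by apply: sumr_ge0 => k _; rewrite -expr2 sqr_ge0.
Qed.

Lemma ediam_le U (r : R) : (forall x y, U x -> U y -> enorm (x - y) <= r) ->
  (ediam U <= r%:E)%E.
Proof.
move=> h; apply: ge_ereal_sup => _ [x Ux] [y Uy] <-.
by rewrite lee_fin h.
Qed.

Lemma ediam_ge0 U : U != set0 -> (0 <= ediam U)%E.
Proof.
move=> /set0P[x Ux]; apply: (@le_trans _ _ (enorm (x - x))%:E).
  by rewrite lee_fin enorm_ge0.
by apply: ereal_sup_ubound; exists x => //; exists x.
Qed.

Lemma diam_pow_ge0 (s : R) U : (0 <= diam_pow s U)%E.
Proof. by rewrite /diam_pow; case: ifP => // _; apply: poweR_ge0. Qed.

Lemma diam_pow_le (s r : R) U : 0 <= s -> 0 <= r ->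
  (ediam U <= r%:E)%E -> (diam_pow s U <= (r `^ s)%:E)%E.
Proof.
move=> s0 r0 h; rewrite /diam_pow; case: ifPn => [_|U0].
  by rewrite lee_fin powR_ge0.
rewrite -poweR_EFin gt0_ler_poweR// in_itv/= leey andbT//.
exact: ediam_ge0.
Qed.

Lemma ediam0 : (ediam (@set0 'rV[R]_2) <= -oo)%E.
Proof. by apply: ge_ereal_sup => z [x []]. Qed.

(** A finite cover is completed by empty sets, which cost nothing whatever the
    exponent. *)
Lemma premeasure_le_seq E (s delta : R) (l : seq (set 'rV[R]_2 * R)) :
  0 <= s ->
  (forall p, p \in l -> 0 <= p.2 <= delta /\ (ediam p.1 <= p.2%:E)%E) ->
  (forall x, E x -> exists2 p, p \in l & p.1 x) ->
  (hausdorff_premeasure s delta E <= (\sum_(p <- l) p.2 `^ s)%:E)%E.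
Proof.
move=> s0 hl cov.
pose V n := (nth (set0, 0) l n).1.
have Vout n : (size l <= n)%N -> V n = set0 by move=> h; rewrite /V nth_default.
apply: (@le_trans _ _ (\sum_(0 <= k <oo) diam_pow s (V k))%E).
  apply: ereal_inf_lbound; exists V => //; split.
    move=> x /cov [p pl px]; exists (index p l) => //.
    by rewrite /V nth_index.
  move=> k; have [kl|kl] := ltnP k (size l).
    have [/andP[_ h1] h2] := hl _ (mem_nth (set0, 0) kl).
    by apply: le_trans h2 _; rewrite lee_fin.
  by rewrite Vout//; apply: le_trans ediam0 _; rewrite leNye.
rewrite (nneseries_split 0 (size l)); last by move=> k _; apply: diam_pow_ge0.
rewrite add0n eseries0 ?adde0; last first.
  by move=> k kl _; rewrite Vout// /diam_pow eqxx.
rewrite -sumEFin (big_nth (set0, 0)) !big_mkord; apply: lee_sum => k _.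
have [/andP[h0 h1] h2] := hl _ (mem_nth (set0, 0) (ltn_ord k)).
exact: diam_pow_le.
Qed.

End hausdorff.

Section grid.
Context (R : realType).
Implicit Types (x y : 'rV[R]_2) (E U : set 'rV[R]_2).

Local Notation i0 := (ord0 : 'I_2).
Local Notation i1 := (ord_max : 'I_2).

Definition boxed (b : nat) E :=
  forall x, E x -> forall i, - (2 ^ b)%:R <= x ord0 i < (2 ^ b)%:R.

(** Position of the coordinate t among the intervals of length 2^-k that subdivide
    [-2^b, 2^b). *)
Definition gidx (b k : nat) (t : R) : nat := Num.truncn ((t + (2 ^ b)%:R) * (2 ^ k)%:R).

Definition gsize (b k : nat) := (2 ^ (k + b.+1))%N.

Lemma gidx_itv b k (t : R) : - (2 ^ b)%:R <= t < (2 ^ b)%:R ->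
  (gidx b k t)%:R <= (t + (2 ^ b)%:R) * (2 ^ k)%:R < (gidx b k t).+1%:R /\
  (gidx b k t < gsize b k)%N.
Proof.
move=> /andP[h1 h2].
have h0 : 0 <= (t + (2 ^ b)%:R) * (2 ^ k)%:R by rewrite mulr_ge0// -lerBlDr sub0r.
have h := truncn_itv h0; split => //.
rewrite /gidx truncn_lt_nat// /gsize expnD expnS natrM mulrC ltr_pM2l ?ltr0n ?expn_gt0//.
rewrite natrM; lra.
Qed.

(** The part of E in a dyadic square of side 2^(b+1-j), described through the finest
    level k of the grid so that the nesting of levels is integer division. *)
Definition cell b k E (j : nat) (c : nat * nat) : set 'rV[R]_2 :=
  [set x | [/\ E x, (gidx b k (x ord0 i0) %/ 2 ^ (k + b.+1 - j))%N = c.1 &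
                    (gidx b k (x ord0 i1) %/ 2 ^ (k + b.+1 - j))%N = c.2]].

Lemma gidx_close b k j (s t : R) : (j <= k + b.+1)%N ->
  - (2 ^ b)%:R <= s < (2 ^ b)%:R -> - (2 ^ b)%:R <= t < (2 ^ b)%:R ->
  (gidx b k s %/ 2 ^ (k + b.+1 - j))%N = (gidx b k t %/ 2 ^ (k + b.+1 - j))%N ->
  `|s - t| <= (2 ^ b.+1)%:R / (2 ^ j)%:R.
Proof.
move=> jk /(gidx_itv k)[/andP[s1 s2] _] /(gidx_itv k)[/andP[t1 t2] _].
move: (gidx b k s) (gidx b k t) s1 s2 t1 t2 => u v s1 s2 t1 t2 uv.
set h := (2 ^ (k + b.+1 - j))%N in uv.
have h0 : (0 < h)%N by rewrite expn_gt0.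
have uvh : (u < v + h)%N /\ (v < u + h)%N.
  have := divn_eq u h; have := divn_eq v h; rewrite uv.
  have := ltn_pmod u h0; have := ltn_pmod v h0; lia.
have n0 : 0 < (2 ^ k)%:R :> R by rewrite ltr0n expn_gt0.
have -> : (2 ^ b.+1)%:R / (2 ^ j)%:R = h%:R / (2 ^ k)%:R :> R.
  apply/eqP; rewrite eqr_div ?pnatr_eq0 -?lt0n ?expn_gt0//; apply/eqP.
  by rewrite -!natrM /h -!expnD subnK// addnC.
rewrite ler_pdivlMr// -[X in _ * X](ger0_norm (ltW n0)) -normrM.
have [uv1 uv2] := uvh.
have {}uv1 : u.+1%:R <= v%:R + h%:R :> R by rewrite -natrD ler_nat.
have {}uv2 : v.+1%:R <= u%:R + h%:R :> R by rewrite -natrD ler_nat.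
by rewrite ler_norml; apply/andP; split; lra.
Qed.

Lemma cell_ediam b k E j c : boxed b E -> (j <= k + b.+1)%N ->
  (ediam (cell b k E j c) <= ((2 ^ b.+2)%:R / (2 ^ j)%:R)%:E)%E.
Proof.
move=> bE jk; apply: ediam_le => x y [Ex x0 x1] [Ey y0 y1].
apply: le_trans (enorm_le _) _; rewrite !mxE.
rewrite expnS mul2n -addnn natrD mulrDl; apply: lerD.
  exact: (gidx_close jk (bE _ Ex i0) (bE _ Ey i0) (etrans x0 (esym y0))).
exact: (gidx_close jk (bE _ Ex i1) (bE _ Ey i1) (etrans x1 (esym y1))).
Qed.

Lemma cell_pow (b j : nat) (s : R) :
  ((2 ^ b.+2)%:R / (2 ^ j)%:R) `^ s = ((2 ^ b.+2)%:R `^ s) * (2 `^ (- s)) ^+ j :> R.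
Proof.
rewrite powRM// ?invr_ge0//; congr (_ * _).
rewrite natrX -[2 ^+ j]powR_mulrn// -powRN -powRrM -[RHS]powR_mulrn ?powR_ge0// -powRrM.
by congr (_ `^ _); ring.
Qed.

(** The constant must not depend on the depth k. Covers that use a cell too
    large to be admissible for delta are handled by the cost of that single cell. *)
Lemma cells_cost_ge b E (s delta eta : R) : boxed b E -> 0 < s -> 0 < delta -> 0 < eta ->
  (eta%:E <= hausdorff_premeasure s delta E)%E ->
  exists2 c : R, 0 < c & forall k (l : seq (nat * (nat * nat))),
    (forall p, p \in l -> (p.1 <= k + b.+1)%N) ->
    (forall x, E x -> exists2 p, p \in l & cell b k E p.1 p.2 x) ->
    c <= \sum_(p <- l) (2 `^ (- s)) ^+ p.1.
Proof.
move=> bE s0 d0 e0 hE; set al : R := 2 `^ (- s).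
have al0 : 0 < al by rewrite powR_gt0.
have al1 : al <= 1 := ltW (pow2N_lt1 s0).
have [j0 hj0] := exists_div_pow2_lt (2 ^ b.+2)%:R d0.
have A0 : 0 < (2 ^ b.+2)%:R `^ s :> R by rewrite powR_gt0// ltr0n expn_gt0.
exists (Num.min (al ^+ j0) (eta / (2 ^ b.+2)%:R `^ s)).
  by rewrite lt_min exprn_gt0// divr_gt0.
move=> k l lK cov; rewrite ge_min.
(* A coarse cell alone costs enough; a cover by fine cells competes in the
   Hausdorff premeasure. *)
have [/hasP[p pl pj]|/hasPn hl] := boolP (has (fun p : nat * (nat * nat) => (p.1 < j0)%N) l).
  apply/orP; left; rewrite (big_rem p)//=.
  apply: (@le_trans _ _ (al ^+ p.1)).
    by rewrite ler_wiXn2l ?(ltW al0)// ltnW.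
  by rewrite lerDl sumr_ge0// => q _; rewrite exprn_ge0// ltW.
apply/orP; right; rewrite ler_pdivrMr//.
rewrite -lee_fin; apply: le_trans hE _.
apply: le_trans (@premeasure_le_seq _ _ s delta
  [seq (cell b k E p.1 p.2, (2 ^ b.+2)%:R / (2 ^ p.1)%:R) | p <- l] (ltW s0) _ _) _.
- move=> _ /mapP[p pl ->] /=; rewrite divr_ge0//=; split.
    by apply/ltW/hj0; rewrite leqNgt; apply: hl.
  by apply: cell_ediam => //; apply: lK.
- move=> x /cov[p pl px]; exists (cell b k E p.1 p.2, (2 ^ b.+2)%:R / (2 ^ p.1)%:R) => //.
  by apply/mapP; exists p.
rewrite lee_fin big_map mulr_suml; apply: ler_sum => p _ /=.
by rewrite cell_pow mulrC.
Qed.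

(** A discrete Frostman measure for E at mesh 2^-k. The constant 25 counts the
    dyadic cells, comparable to a ball, that may meet it. *)
Definition frostman_weights (b k : nat) E (c al : R) :=
  exists (I : finType) (w : I -> R) (p1 p2 : I -> int),
  [/\ forall u, 0 <= w u,
      c <= \sum_u w u <= 1,
      forall u, `|p1 u| <= (2 ^ b * 2 ^ k)%:Z /\ `|p2 u| <= (2 ^ b * 2 ^ k)%:Z,
      ball_bound w p1 p2 k 25 al &
      forall u, exists2 x, E x &
        `|x ord0 i0 * (2 ^ k)%:R - (p1 u)%:~R| <= 1 /\
        `|x ord0 i1 * (2 ^ k)%:R - (p2 u)%:~R| <= 1].

Lemma divn_close (h x y : nat) (X z : int) : (0 < h)%N ->
  `|x%:Z - X - z| < h%:Z -> `|y%:Z - X - z| < h%:Z ->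
  (x %/ h + 2 - y %/ h < 5)%N /\ (y %/ h <= x %/ h + 2)%N.
Proof.
move=> h0 hx hy; have := divn_eq x h; have := divn_eq y h.
have := ltn_pmod x h0; have := ltn_pmod y h0.
move: (x %/ h)%N (x %% h)%N (y %/ h)%N (y %% h)%N => x' rx y' ry ? ? ? ?.
have : (x' * h < (y' + 3) * h)%N by lia.
have : (y' * h < (x' + 3) * h)%N by lia.
by rewrite !ltn_mul2r h0 /= => ? ?; lia.
Qed.

Lemma centered_le (n X : nat) : (n < X * 2)%N -> `|n%:Z - X%:Z| <= X%:Z.
Proof. by lia. Qed.

(** [frostman_tree] applied to the tree of occupied dyadic cells, whose covers are
    never cheap by [cells_cost_ge]; balls are covered by boundedly many cells. *)
Lemma discrete_frostman b E (s delta eta : R) :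
  boxed b E -> 0 < s -> 0 < delta -> 0 < eta ->
  (eta%:E <= hausdorff_premeasure s delta E)%E ->
  exists2 c : R, 0 < c & forall k, frostman_weights b k E c (2 `^ (- s)).
Proof.
move=> bE s0 d0 e0 hE.
have [c c0 hc] := cells_cost_ge bE s0 d0 e0 hE.
exists c => // k; set al : R := 2 `^ (- s) in hc *.
have al0 : 0 < al by rewrite powR_gt0.
have al1 : al <= 1 := ltW (pow2N_lt1 s0).
set D := gsize b k; set K := (k + b.+1)%N.
(* The leaves of the tree are the cells of side 2 ^ - k that meet E. *)
pose occ (u : 'I_D * 'I_D) := `[< exists x, [/\ E x, gidx b k (x ord0 i0) = u.1 &
   gidx b k (x ord0 i1) = u.2] >].
pose I : finType := {u : 'I_D * 'I_D | occ u}.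
pose n1 (u : I) : nat := (val u).1.
pose n2 (u : I) : nat := (val u).2.
pose blk j (u : I) := ((n1 u %/ 2 ^ (K - j))%N, (n2 u %/ 2 ^ (K - j))%N).
have blk_coarse j u v : (j < K)%N -> blk j.+1 u = blk j.+1 v -> blk j u = blk j v.
  move=> jK; rewrite /blk (_ : K - j = (K - j.+1).+1)%N; last by lia.
  rewrite expnSr !divnMA => -[-> ->]; reflexivity.
have blk_inj : injective (blk K).
  move=> u v; rewrite /blk subnn expn0 !divn1 => -[h1 h2].
  apply/val_inj; move: h1 h2; rewrite /n1 /n2.
  by case: (val u) => a a'; case: (val v) => d d' /= /val_inj -> /val_inj ->.
have [w [lev [w0 wle levK wcov]]] :=
  frostman_tree (fun j => exprn_gt0 j al0) blk_coarse blk_inj.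
have nD (u : I) : (n1 u < D)%N /\ (n2 u < D)%N by split; apply: ltn_ord.
have DE : D = (2 ^ b * 2 ^ k * 2)%N by rewrite /D /gsize expnD expnS; ring.
exists I, w, (fun u => (n1 u)%:Z - (2 ^ b * 2 ^ k)%:Z), (fun u => (n2 u)%:Z - (2 ^ b * 2 ^ k)%:Z).
split=> //.
- apply/andP; split.
    apply: le_trans wcov; apply: hc.
      move=> p; rewrite mem_undup => /mapP[u _ ->]; exact: levK.
    move=> x Ex.
    have [_ l1] := gidx_itv k (bE _ Ex i0); have [_ l2] := gidx_itv k (bE _ Ex i1).
    have ou : occ (Ordinal l1, Ordinal l2) by apply/asboolP; exists x.
    pose u : I := Sub (Ordinal l1, Ordinal l2) ou.
    exists (lev u, blk (lev u) u) => //.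
    by rewrite mem_undup; apply/mapP; exists u => //; rewrite mem_enum.
  have [u _|I0] := pickP I; last by rewrite big_pred0.
  have := wle 0%N u (leq0n _); rewrite expr0; apply: le_trans.
  rewrite le_eqVlt; apply/orP; left; apply/eqP; apply: eq_bigl => v.
  have [u1 u2] := nD u; have [v1 v2] := nD v.
  by rewrite /blk subn0 !divn_small//; apply/esym/eqP.
- by move=> u; have [] := nD u; rewrite DE => h1 h2; split; apply: centered_le.
- move=> j z1 z2 jk; set h := (2 ^ (k - j))%N.
  have h0 : (0 < h)%N by rewrite expn_gt0.
  pose S (m : I) := (`|(n1 m)%:Z - (2 ^ b * 2 ^ k)%:Z - z1| < h%:Z) &&
                    (`|(n2 m)%:Z - (2 ^ b * 2 ^ k)%:Z - z2| < h%:Z).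
  rewrite -[leLHS]/(\sum_(m | S m) w m).
  have [u0 Su0|S0] := pickP S; last by rewrite big_pred0// mulr_ge0// exprn_ge0// ltW.
  have jK : (j + b.+1 <= K)%N by rewrite leq_add2r.
  have hE2 : (K - (j + b.+1) = k - j)%N by rewrite subnDr.
  (* The quotients by h of two points of one ball differ by at most 2, hence
     5 * 5 blocks suffice; the addition of 2 keeps the offset a in nat. *)
  pose near (a : 'I_5 * 'I_5) (m : I) := (n1 m %/ h + 2 == n1 u0 %/ h + a.1)%N &&
     (n2 m %/ h + 2 == n2 u0 %/ h + a.2)%N.
  apply: (@le_trans _ _ (\sum_(a : 'I_5 * 'I_5) \sum_(m | near a m) w m)).
    rewrite (exchange_big_dep xpredT)//= [leLHS]big_mkcond; apply: ler_sum => m _.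
    case: ifPn => [Sm|_]; last by apply: sumr_ge0.
    rewrite sumr_const -[leLHS]mulr1n ler_wpMn2l//.
    move: Sm Su0; rewrite /S => /andP[s1 s2] /andP[s3 s4].
    have [c1 c2] := divn_close h0 s1 s3; have [c3 c4] := divn_close h0 s2 s4.
    apply/card_gt0P; exists (Ordinal c1, Ordinal c3).
    by rewrite unfold_in /near /= !subnKC// !eqxx.
  apply: (@le_trans _ _ (\sum_(a : 'I_5 * 'I_5) al ^+ j)); last first.
    by rewrite sumr_const card_prod card_ord mulr_natl.
  apply: ler_sum => a _; have [v nv|n0] := pickP (near a); last first.
    by rewrite big_pred0// exprn_ge0// ltW.
  apply: (@le_trans _ _ (al ^+ (j + b.+1))); last first.
    by rewrite ler_wiXn2l ?(ltW al0)// leq_addr.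
  apply: le_trans (wle _ v jK); rewrite /blk hE2 -/h.
  rewrite big_mkcond [leRHS]big_mkcond; apply: ler_sum => m _.
  case: ifPn => [nm|_]; last by case: ifP.
  case: ifPn => // /negP[]; apply/eqP; move: nm nv; rewrite /near.
  by move=> /andP[/eqP m1 /eqP m2] /andP[/eqP v1 /eqP v2]; congr pair;
    apply: (@addIn 2); rewrite ?m1 ?m2 ?v1 ?v2.
- move=> u; have /asboolP[x [Ex x0 x1]] := valP u.
  have pE (n : nat) : (n%:Z - (2 ^ b * 2 ^ k)%:Z)%:~R = n%:R - (2 ^ b)%:R * (2 ^ k)%:R :> R.
    by rewrite intrB -natrM.
  exists x => //; rewrite !pE.
  have [/andP[a1 a2] _] := gidx_itv k (bE _ Ex i0); have [/andP[a3 a4] _] := gidx_itv k (bE _ Ex i1).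
  move: a1 a2 a3 a4; rewrite x0 x1 -/(n1 u) -/(n2 u) -!natr1 => a1 a2 a3 a4.
  by split; rewrite ler_norml; apply/andP; split; lra.
Qed.

End grid.

Section dimension.
Context (R : realType).
Implicit Types (x y : 'rV[R]_2) (E U : set 'rV[R]_2).

Local Notation i0 := (ord0 : 'I_2).
Local Notation i1 := (ord_max : 'I_2).

Lemma premeasure_ge0 (s delta : R) E : (0 <= hausdorff_premeasure s delta E)%E.
Proof.
apply: le_ereal_inf_tmp => _ [V _ <-].
by apply: nneseries_ge0 => k _ _; apply: diam_pow_ge0.
Qed.

Lemma hausdorff_measure_ge0 (s : R) E : (0 <= hausdorff_measure s E)%E.
Proof.
apply: (@le_trans _ _ (hausdorff_premeasure s 1 E)); first exact: premeasure_ge0.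
by apply: ereal_sup_ubound; exists 1 => //=.
Qed.

Lemma hausdorff_dim_ge0 E : (0 <= hausdorff_dim E)%E.
Proof. by apply: le_ereal_inf_tmp => _ [s [s0 _] <-]; rewrite lee_fin. Qed.

Lemma premeasure_gt0 (s : R) E : 0 <= s -> (s%:E < hausdorff_dim E)%E ->
  exists delta eta : R, [/\ 0 < delta, 0 < eta &
    (eta%:E <= hausdorff_premeasure s delta E)%E].
Proof.
move=> s0 sE.
have : (0 < hausdorff_measure s E)%E.
  rewrite lt0e hausdorff_measure_ge0 andbT; apply/eqP => h.
  move: sE; rewrite ltNge => /negP; apply.
  by apply: ereal_inf_lbound; exists s.
move=> /ereal_sup_gt[_ [delta d0 <-]] h.
have hn := premeasure_ge0 s delta E.
case e: (hausdorff_premeasure s delta E) h hn => [r| |] // h _.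
- by exists delta, r; rewrite e; split => //; rewrite -lte_fin.
- by exists delta, 1; rewrite e leey; split.
Qed.

(** For exponent s > 2 the 4^K cells of side 2^(b+1-K) have total cost
    O((4 * 2^-s)^K), which tends to 0. *)
Lemma hausdorff_dim_le2 b E : boxed b E -> (hausdorff_dim E <= 2%:E)%E.
Proof.
move=> bE; apply/lee_addgt0Pr => e e0; rewrite -EFinD.
apply: ereal_inf_lbound; exists (2 + e) => //; split; first by rewrite addr_ge0// ltW.
apply/eqP; rewrite eq_le hausdorff_measure_ge0 andbT.
apply: ge_ereal_sup => _ [delta /= d0 <-].
set s := 2 + e; set al : R := 2 `^ (- s).
have al0 : 0 < al by rewrite powR_gt0.
have al4 : 4 * al < 1.
  have -> : 4 = 2 `^ 2 :> R by rewrite powR_mulrn// -natrX.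
  rewrite /al /s -powRD; last by rewrite pnatr_eq0 implybT.
  by rewrite opprD addrA subrr sub0r; exact: pow2N_lt1.
have [j0 hj0] := exists_div_pow2_lt (2 ^ b.+2)%:R d0.
set A : R := (2 ^ b.+2)%:R `^ s.
have key k : (j0 <= k)%N -> (hausdorff_premeasure s delta E <= (A * (4 * al) ^+ (k + b.+1))%:E)%E.
  move=> jk; set K := (k + b.+1)%N; set r := (2 ^ b.+2)%:R / (2 ^ K)%:R : R.
  pose cl (u : 'I_(gsize b k) * 'I_(gsize b k)) := cell b k E K (val u.1, val u.2).
  apply: le_trans (@premeasure_le_seq _ _ s delta
    [seq (cl u, r) | u <- enum [set: 'I_(gsize b k) * 'I_(gsize b k)]%SET] _ _ _) _.
  - by rewrite addr_ge0// ltW.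
  - move=> _ /mapP[u _ ->] /=; rewrite /r divr_ge0//=; split.
      by apply/ltW/hj0; apply: leq_trans jk (leq_addr _ _).
    exact: cell_ediam.
  - move=> x Ex.
    have [_ l1] := gidx_itv k (bE _ Ex i0); have [_ l2] := gidx_itv k (bE _ Ex i1).
    exists (cl (Ordinal l1, Ordinal l2), r).
      by apply/mapP; exists (Ordinal l1, Ordinal l2) => //; rewrite mem_enum finset.in_setT.
    by split; rewrite //= subnn expn0 divn1.
  rewrite lee_fin big_map /= big_const_seq count_predT -cardE finset.cardsT card_prod card_ord.
  rewrite iter_addr_0 /= /r cell_pow -/A -/al -[leLHS]mulr_natl exprMn.
  rewrite natrM /gsize natrX -/K le_eqVlt; apply/orP; left; apply/eqP.
  have -> : 4 ^+ K = 2 ^+ K * 2 ^+ K :> R by rewrite -exprMn -natrM.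
  by ring.
case e1: (hausdorff_premeasure s delta E) (premeasure_ge0 s delta E) => [r| |]//; last first.
  by have := key j0 (leqnn _); rewrite e1.
rewrite lee_fin => r0; rewrite lee_fin leNgt; apply/negP => rp.
have A0 : 0 < A by rewrite powR_gt0// ltr0n expn_gt0.
have x0 : 0 <= 4 * al by rewrite mulr_ge0// ltW.
have [n hn] : exists n, (4 * al) ^+ n <= r / (2 * A).
  by apply: exists_exp_le => //; rewrite divr_gt0 ?mulr_gt0.
have := key (maxn n j0) (leq_maxr _ _); rewrite e1 lee_fin.
apply/negP; rewrite -ltNge; apply: (@le_lt_trans _ _ (A * (r / (2 * A)))).
  rewrite ler_pM2l//; apply: le_trans hn; rewrite ler_wiXn2l// ?ltW//.
  by rewrite (leq_trans (leq_maxl n j0)) ?leq_addr.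
by rewrite (_ : A * _ = r / 2); [lra | field; rewrite gt_eqF].
Qed.

Lemma compact_boxed E : compact E -> exists b, boxed b E.
Proof.
move=> /compact_bounded[M [_ hM]].
pose M' := Num.max M 0 + 1.
have hM' : M < M' by rewrite /M' ltr_pwDr// le_max lexx.
exists (Num.truncn M').+1 => x Ex i.
have := hM _ hM' _ Ex; rewrite /= => hx.
have hxi : `|x ord0 i| <= M'.
  apply: le_trans hx; rewrite -[`|x|]/(mx_norm x) mx_normrE.
  exact: (le_bigmax _ (fun ij : 'I_1 * 'I_2 => `|x ij.1 ij.2|) (ord0, i)).
have hb : M' < (2 ^ (Num.truncn M').+1)%:R.
  apply: lt_le_trans (truncnS_gt _) _; rewrite ler_nat; exact: ltnW (ltn_expl _ _).
have {}hxi := le_lt_trans hxi hb.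
by rewrite ltr_norml in hxi; case/andP: hxi => h1 h2; rewrite h2 ltW.
Qed.

End dimension.

Section square.
Context (R : realType).
Implicit Types (x y : 'rV[R]_2) (E U : set 'rV[R]_2).

Local Notation i0 := (ord0 : 'I_2).
Local Notation i1 := (ord_max : 'I_2).

Definition square : set 'rV[R]_2 := [set v | forall i, `[0, 1]%classic (v ord0 i)].

Lemma square_compact : compact square.
Proof. by apply: (@rV_compact _ 2 (fun=> `[(0:R), 1]%classic)) => i; apply: segment_compact. Qed.

Local Notation leb := (@lebesgue_measure R).
Local Notation area := (leb \x leb)%E.

(** A square that contains U, of side twice the diameter; the centre is an
    arbitrary point of U. *)
Definition hull U : set (measurableTypeR R * measurableTypeR R) :=
  if U == set0 then set0 else
  `[(xget 0 U) ord0 i0 - fine (ediam U), (xget 0 U) ord0 i0 + fine (ediam U)] `*`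
  `[(xget 0 U) ord0 i1 - fine (ediam U), (xget 0 U) ord0 i1 + fine (ediam U)].

Lemma measurable_hull U : measurable (hull U).
Proof. by rewrite /hull; case: ifP => // _; apply: measurableX. Qed.

Lemma fine_ediam U : (ediam U <= 1%:E)%E -> U != set0 ->
  ediam U = (fine (ediam U))%:E /\ 0 <= fine (ediam U) <= 1.
Proof.
move=> U1 U0; have := ediam_ge0 U0; move: U1.
by case: (ediam U) => [r| |]//; rewrite !lee_fin => -> ->.
Qed.

Lemma hull_sub U x : (ediam U <= 1%:E)%E -> U x -> hull U (x ord0 i0, x ord0 i1).
Proof.
move=> U1 Ux; have U0 : U != set0 by apply/set0P; exists x.
have [dE _] := fine_ediam U1 U0.
rewrite /hull (negPf U0); set z := xget 0 U.
have Uz : U z by apply: (@xgetPex _ _ U); exists x.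
have h i : `|x ord0 i - z ord0 i| <= fine (ediam U).
  rewrite -lee_fin -dE; apply: (@le_trans _ _ (enorm (x - z))%:E).
    by rewrite lee_fin; have := coord_le_enorm (x - z) i; rewrite !mxE.
  by apply: ereal_sup_ubound; exists x => //; exists z.
by split; rewrite /= in_itv /= -ler_distl.
Qed.

Lemma leb_ball (a d : R) : 0 <= d -> leb `[a - d, a + d] = (2 * d)%:E.
Proof.
move=> d0; rewrite lebesgue_measure_itv /= lte_fin.
case: ltP => h; first by rewrite -EFinD; congr EFin; ring.
by congr EFin; lra.
Qed.

Lemma area_rect (i j : interval R) :
  area ([set` i] `*` [set` j]) = (leb [set` i] * leb [set` j])%E.
Proof. by rewrite product_measure1E. Qed.

Lemma area_hull (s : R) U : 0 <= s -> s <= 2 -> (ediam U <= 1%:E)%E ->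
  (area (hull U) <= 4%:E * diam_pow s U)%E.
Proof.
move=> s0 s2 U1; rewrite /hull /diam_pow; case: ifPn => [_|U0].
  by rewrite measure0 mule0.
have [] := fine_ediam U1 U0; move: (fine (ediam U)) => d -> /andP[d0 d1].
rewrite area_rect !leb_ball// poweR_EFin -!EFinM lee_fin.
rewrite mulrACA -natrM ler_wpM2l//.
move: d0; rewrite le_eqVlt => /predU1P[<-|d0]; first by rewrite mul0r powR_ge0.
rewrite -expr2 -powR_mulrn ?(ltW d0)//; apply: ger_powR => //.
by rewrite d0.
Qed.

(** A cover of the square by sets of diameter at most 1 has
    sum of 4 diam^s >= sum of 4 diam^2 >= area of the square. *)
Lemma square_hausdorff_neq0 (s : R) : 0 <= s -> s <= 2 -> hausdorff_measure s square <> 0%E.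
Proof.
move=> s0 s2 h.
have : (hausdorff_premeasure s 1 square < (5^-1)%:E)%E.
  apply: (@le_lt_trans _ _ (hausdorff_measure s square)).
    by apply: ereal_sup_ubound; exists 1 => //=.
  by rewrite h lte_fin invr_gt0.
move=> /ereal_inf_lt[_ [V [cov V1] <-]] lt5.
have : (area (`[0%R, 1%R] `*` `[0%R, 1%R]) <= \sum_(0 <= k <oo) area (hull (V k)))%E.
  apply: measure_sigma_subadditive => //.
  - by move=> k; apply: measurable_hull.
  - by apply: measurableX.
  - move=> [a b] [/= ha hb].
    pose x : 'rV[R]_2 := \row_i (if i == i0 then a else b).
    have /cov[k _ Vx] : square x.
      by move=> i; rewrite /x mxE; case: ifP.
    exists k => //; have := hull_sub (V1 k) Vx.
    by rewrite /x !mxE.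
rewrite area_rect lebesgue_measure_itv /= lte_fin ltr01 sube0 mule1.
apply/negP; rewrite -ltNge.
apply: (@le_lt_trans _ _ (\sum_(0 <= k <oo) (4%:E * diam_pow s (V k))))%E.
  by apply: lee_nneseries => k _ => //; apply: area_hull.
rewrite nneseriesZl; last by move=> k _; apply: diam_pow_ge0.
apply: (@le_lt_trans _ _ (4%:E * (5^-1)%:E)%E).
  by rewrite lee_wpmul2l// ltW.
by rewrite -EFinM lte_fin; lra.
Qed.

Lemma square_boxed : boxed 1 square.
Proof.
by move=> x xs i; have := xs i; rewrite /= in_itv /= => /andP[h1 h2]; apply/andP; split; lra.
Qed.

Lemma hausdorff_dim_square : hausdorff_dim square = 2%:E.
Proof.
apply/eqP; rewrite eq_le (hausdorff_dim_le2 square_boxed) /=.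
apply: le_ereal_inf_tmp => _ [s [s0 sH] <-]; rewrite lee_fin leNgt; apply/negP => s2.
exact: square_hausdorff_neq0 s0 (ltW s2) sH.
Qed.

End square.

(** * Positive Lebesgue measure from dyadic intervals *)

Section lebesgue.
Context (R : realType).
Local Notation leb := (@lebesgue_measure R).

(** A Lebesgue number for the cover of S by the single open set U. *)
Lemma compact_open_margin (S U : set R) (c : R) : compact S -> open U -> S `<=` U ->
  exists n0 : nat, forall n, (n0 <= n)%N ->
    forall s t : R, S s -> `|t - s| <= c / (2 ^ n)%:R -> U t.
Proof.
move=> /compact_near_coveringP cS oU SU.
pose P (n : nat) (s : R) := forall t, `|t - s| <= c / (2 ^ n)%:R -> U t.
suff loc x : S x -> \forall x' \near x & n \near \oo, P n x'.
  by have [n _ hn] := cS nat \oo P _ loc; exists n => m nm s t Ss; apply: (hn m nm).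
move=> Sx; have /(@nbhs_ballP R R)[e /= e0 eU] : nbhs x U by apply: open_nbhs_nbhs; split=> //; apply: SU.
have e2 : 0 < e / 2 by rewrite divr_gt0.
have [n0 hn0] := exists_div_pow2_lt c e2.
exists (ball x (e / 2), [set n | (n0 <= n)%N]).
  by split; [exact: nbhsx_ballx | exists n0].
move=> [y n] /= [xy n0n] t ty; apply: eU.
rewrite /ball /= in xy *; have := hn0 _ n0n; rewrite distrC => h.
have -> : t - x = (t - y) + (y - x) by ring.
rewrite (le_lt_trans (ler_normD _ _))//.
by rewrite distrC in xy; lra.
Qed.

Lemma dyadic_itv_measure (k : nat) (t : int) :
  leb `[t%:~R / (2 ^ k)%:R, (t + 1)%:~R / (2 ^ k)%:R[ = ((2 ^ k)%:R^-1)%:E.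
Proof.
have k0 : 0 < (2 ^ k)%:R :> R by rewrite ltr0n expn_gt0.
rewrite lebesgue_measure_itv /= lte_fin ltr_pM2r ?invr_gt0// ltr_int ltzD1 lexx.
by rewrite -EFinB -mulrBl rmorphD /= [_ + 1]addrC addrK mul1r.
Qed.

Lemma dyadic_union_measure (k : nat) (l : seq int) : uniq l ->
  leb (\big[setU/set0]_(i < size l)
     `[(l`_i)%:~R / (2 ^ k)%:R, (l`_i + 1)%:~R / (2 ^ k)%:R[%classic) =
  ((size l)%:R / (2 ^ k)%:R)%:E.
Proof.
move=> ul; rewrite measure_bigsetU_ord//=.
  under eq_bigr do rewrite dyadic_itv_measure.
  by rewrite sumEFin sumr_const card_ord mulr_natl.
have k0 : 0 < (2 ^ k)%:R :> R by rewrite ltr0n expn_gt0.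
move=> i j _ _ [x []]; rewrite /= !in_itv /= => /andP[i1 i2] /andP[j1 j2].
apply/val_inj/eqP; rewrite -(nth_uniq 0 (ltn_ord i) (ltn_ord j) ul).
have := le_lt_trans i1 j2; have := le_lt_trans j1 i2.
rewrite !ltr_pM2r ?invr_gt0// !ltr_int => h1 h2.
by rewrite eq_le -!ltzD1 h1 h2.
Qed.

(** A null compact set has a neighbourhood U of measure below c, and U contains
    the dyadic intervals [t / 2^k, (t+1) / 2^k) once k is large; these are
    disjoint, of total measure at least c. *)
Lemma lebesgue_gt0 (S : set R) (c C : R) (k1 : nat) : compact S -> 0 < c ->
  (forall k : nat, (k1 <= k)%N -> exists2 l : seq int, uniq l /\ c * (2 ^ k)%:R <= (size l)%:R &
     forall t, t \in l -> exists2 s, S s & `|s * (2 ^ k)%:R - t%:~R| <= C) ->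
  (0 < leb S)%E.
Proof.
move=> cS c0 hS; rewrite lt0e measure_ge0 andbT; apply/eqP => S0.
have mS := compact_measurable cS.
have [U [oU SU US]] : exists U : set R, [/\ open U , S `<=` U & (leb (U `\` S) < c%:E)%E].
  have Soo : (leb S < +oo)%E by rewrite S0.
  exact: lebesgue_regularity_outer mS Soo c0.
have [k0' hk'] := compact_open_margin (C + 1) cS oU SU.
pose k := maxn k0' k1; have hk := hk' k (leq_maxl _ _).
have [l [ul cl] hl] := hS k (leq_maxr _ _).
have k0 : 0 < (2 ^ k)%:R :> R by rewrite ltr0n expn_gt0.
have mU := open_measurable oU.
have lU : (((size l)%:R / (2 ^ k)%:R)%:E <= leb U)%E.
  rewrite -(dyadic_union_measure k ul); apply: le_measure; rewrite ?inE//.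
    by apply: bigsetU_measurable.
  move=> x; rewrite -(bigcup_mkord (size l) (fun i =>
    `[(l`_i)%:~R / (2 ^ k)%:R, (l`_i + 1)%:~R / (2 ^ k)%:R[%classic)) => -[i /= il].
  rewrite in_itv /= => /andP[i1 i2].
  have [s Ss hs] := hl _ (mem_nth 0 il).
  apply: (hk s) => //.
  rewrite ler_pdivlMr// -[X in _ * X](ger0_norm (ltW k0)) -normrM mulrBl.
  rewrite ler_pdivrMr// in i1; rewrite ltr_pdivlMr// in i2.
  rewrite rmorphD /= in i2.
  move: hs; rewrite !ler_norml => /andP[h1 h2]; apply/andP; split; lra.
have : (leb U < c%:E)%E.
  apply: le_lt_trans US; rewrite -{1}(setDUK SU) measureU//=.
  - by rewrite S0 add0e.
  - exact: measurableD.
  - by apply/seteqP; split => [x [Sx [_ nSx]]|x []] //; exact: nSx.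
rewrite ltNge => /negP; apply; apply: le_trans lU.
by rewrite lee_fin ler_pdivlMr.
Qed.

End lebesgue.

(** * The product set *)

Section discrete_size.
Context (R : realType).

(** Cauchy-Schwarz over the occupied intervals of length N: pairs in the same
    interval are at distance less than N. *)
Lemma sqr_sum_le_size (A : finType) (w : A -> R) (s : A -> int) (N : nat) :
  (0 < N)%N -> (forall a, 0 <= w a) ->
  (\sum_a w a) ^+ 2 <= (size (undup [seq (s a %/ N)%Z | a <- enum A]))%:R *
     \sum_a \sum_(b | `|s a - s b| < N%:Z) w a * w b.
Proof.
move=> N0 w0; pose key a := (s a %/ N)%Z.
set l := undup _; pose f t := \sum_(a | key a == t) w a.
have -> : \sum_a w a = \sum_(i < size l) 1 * f l`_i.
  under [RHS]eq_bigr do rewrite mul1r.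
  by rewrite (sum_by_key key) (big_nth 0) big_mkord.
apply: le_trans (sqr_wsum_le _ _) _ => //.
rewrite sumr_const card_ord ler_wpM2l//.
under eq_bigr do rewrite mul1r.
rewrite -(big_mkord xpredT (fun i => f l`_i ^+ 2)) -(big_nth 0 xpredT (fun t => f t ^+ 2)).
rewrite [leRHS](sum_by_key key) ler_sum// => t _.
rewrite expr2 /f mulr_suml; apply: ler_sum => a /eqP at'; rewrite mulr_sumr.
rewrite big_mkcond [leRHS]big_mkcond; apply: ler_sum => b _.
case: ifPn => [/eqP bt|_]; last by case: ifP => // _; apply: mulr_ge0.
case: ifPn => // /negP[].
have := divz_eq (s a) N; have := divz_eq (s b) N.
have Nz : N%:Z != 0 by lia.
have := modz_ge0 (s a) Nz; have := modz_ge0 (s b) Nz.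
have Nz0 : 0 < N%:Z by lia.
have := ltz_pmod (s a) Nz0; have := ltz_pmod (s b) Nz0.
rewrite -/(key a) -/(key b) at' bt; lia.
Qed.

(** The points discarded lie in one ball of radius 2^-r around the origin, of
    mass at most c / 2. *)
Lemma far_restrict (I : finType) (w : I -> R) (p1 p2 : I -> int) (r k : nat) (C c al : R) :
  (forall u, 0 <= w u) -> ball_bound w p1 p2 k C al -> (r <= k)%N ->
  C * al ^+ r <= c / 2 -> c <= \sum_u w u ->
  exists w' : I -> R,
  [/\ forall u, 0 <= w' u <= w u, c / 2 <= \sum_u w' u, ball_bound w' p1 p2 k C al &
      forall u, w' u != 0 ->
        ((2 ^ k)%:Z <= (2 ^ r)%:Z * `|p1 u|) || ((2 ^ k)%:Z <= (2 ^ r)%:Z * `|p2 u|)].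
Proof.
move=> w0 hb rk hr hc.
pose w' u := if ((2 ^ k)%:Z <= (2 ^ r)%:Z * `|p1 u|) || ((2 ^ k)%:Z <= (2 ^ r)%:Z * `|p2 u|)
     then w u else 0.
exists w'.
have w'w u : 0 <= w' u <= w u by rewrite /w'; case: ifP => _; rewrite ?lexx w0.
split=> //; last first.
- by move=> u; rewrite /w'; case: ifP => //; rewrite eqxx.
- move=> j z1 z2 jk; apply: le_trans (hb j z1 z2 jk).
  by apply: ler_sum => u _; case/andP: (w'w u).
set near : pred I := fun u => (`|p1 u - 0| < (2 ^ (k - r))%:Z) && (`|p2 u - 0| < (2 ^ (k - r))%:Z).
have hn : \sum_(u | near u) w u <= c / 2 by apply: le_trans hr; apply: hb.
suff : \sum_u w u <= \sum_u w' u + \sum_(u | near u) w u by lra.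
rewrite [X in _ + X]big_mkcond -big_split /=; apply: ler_sum => u _.
rewrite /w'; case: ifPn => [_|]; first by case: ifP; rewrite ?addr0// lerDl.
rewrite negb_or -!ltNge => /andP[h1 h2].
have kr : (2 ^ k = 2 ^ r * 2 ^ (k - r))%N by rewrite -expnD subnKC.
have r0 : 0 < (2 ^ r)%:Z by rewrite ltz_nat expn_gt0.
by rewrite /near !subr0 ifT ?add0r//; apply/andP; split;
  [move: h1|move: h2]; rewrite kr PoszM ltr_pM2l.
Qed.

End discrete_size.

Section compactness.
Context (R : realType).
Implicit Types (E F H : set 'rV[R]_2).

(** It is the image of E * F * H under a polynomial map. *)
Lemma dot_set_compact E F H : compact E -> compact F -> compact H ->
  compact (dot_set E (sum_set F H)).
Proof.
move=> cE cF cH.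
pose f (t : 'rV[R]_2 * ('rV[R]_2 * 'rV[R]_2)) : R := dotv t.1 (t.2.1 + t.2.2).
have -> : dot_set E (sum_set F H) = f @` (E `*` (F `*` H)).
  apply/seteqP; split=> [_ [x Ex [_ [y Fy [z Hz <-]] <-]]|_ [[x [y z]] [/= Ex [Fy Hz]] <-]].
    by exists (x, (y, z)).
  by exists x => //; exists (y + z) => //; exists y => //; exists z.
apply: continuous_compact; last by apply: compact_setX => //; apply: compact_setX.
apply: continuous_subspaceT.
have -> : f = fun t => t.1 ord0 ord0 * (t.2.1 ord0 ord0 + t.2.2 ord0 ord0) +
    t.1 ord0 ord_max * (t.2.1 ord0 ord_max + t.2.2 ord0 ord_max).
  by apply/funext => t; rewrite /f dotv2 !mxE.
have c1 (i : 'I_2) : continuous (fun t : 'rV[R]_2 * ('rV[R]_2 * 'rV[R]_2) => t.1 ord0 i).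
  move=> t; apply: (@continuous_comp _ _ _ fst (fun x : 'rV[R]_2 => x ord0 i)).
    exact: cvg_fst.
  exact: coord_continuous.
have c2 (i : 'I_2) : continuous (fun t : 'rV[R]_2 * ('rV[R]_2 * 'rV[R]_2) => t.2.1 ord0 i).
  move=> t; apply: (@continuous_comp _ _ _ (fun t => t.2.1) (fun x : 'rV[R]_2 => x ord0 i)).
    by apply: (@continuous_comp _ _ _ snd fst); [exact: cvg_snd|exact: cvg_fst].
  exact: coord_continuous.
have c3 (i : 'I_2) : continuous (fun t : 'rV[R]_2 * ('rV[R]_2 * 'rV[R]_2) => t.2.2 ord0 i).
  move=> t; apply: (@continuous_comp _ _ _ (fun t => t.2.2) (fun x : 'rV[R]_2 => x ord0 i)).
    by apply: (@continuous_comp _ _ _ snd snd); exact: cvg_snd.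
  exact: coord_continuous.
move=> t; apply: cvgD; apply: cvgM; first exact: c1; last first.
- by apply: cvgD; [exact: c2|exact: c3].
- exact: c1.
- by apply: cvgD; [exact: c2|exact: c3].
Qed.

End compactness.

Section main.
Context (R : realType).
Implicit Types (E F H : set 'rV[R]_2).
Local Notation i0 := (ord0 : 'I_2).
Local Notation i1 := (ord_max : 'I_2).

Lemma hausdorff_dim_set1 (x : 'rV[R]_2) : hausdorff_dim [set x] = 0%E.
Proof.
apply/eqP; rewrite eq_le hausdorff_dim_ge0 andbT.
apply/lee_addgt0Pr => e e0; rewrite add0e.
apply: ereal_inf_lbound; exists e => //; split; first exact: ltW.
apply/eqP; rewrite eq_le hausdorff_measure_ge0 andbT.
apply: ge_ereal_sup => _ [d /= d0 <-].
apply: le_trans (@premeasure_le_seq _ _ e d [:: ([set x], 0)] (ltW e0) _ _) _.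
- move=> p; rewrite inE => /eqP -> /=; rewrite lexx ltW//; split=> //.
  apply: ediam_le => _ _ -> ->.
  by rewrite subrr /enorm dotv2 !mxE mul0r addr0 sqrtr0.
- by move=> y ->; exists ([set x], 0) => //; rewrite inE.
by rewrite big_seq1 /= powR0 ?gt_eqF.
Qed.

Lemma boxed_le b b' E : (b <= b')%N -> boxed b E -> boxed b' E.
Proof.
move=> bb bE x Ex i; have /andP[h1 h2] := bE x Ex i.
have h : (2 ^ b)%:R <= (2 ^ b')%:R :> R by rewrite ler_nat leq_exp2l.
by apply/andP; split; [apply: le_trans h1; rewrite lerN2|apply: lt_le_trans h2 h].
Qed.

Lemma hausdorff_dim_fin b E : boxed b E ->
  exists2 a : R, hausdorff_dim E = a%:E & 0 <= a <= 2.
Proof.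
move=> bE; have := hausdorff_dim_ge0 E; have := hausdorff_dim_le2 bE.
by case: (hausdorff_dim E) => [a| |]//; rewrite !lee_fin => a2 a0; exists a => //; rewrite a0.
Qed.

Lemma frostman_of_dim b E (s : R) : boxed b E -> 0 < s -> (s%:E < hausdorff_dim E)%E ->
  exists2 c : R, 0 < c & forall k, frostman_weights b k E c (2 `^ (- s)).
Proof.
move=> bE s0 sE; have [delta [eta [d0 e0 h]]] := premeasure_gt0 (ltW s0) sE.
exact: discrete_frostman bE s0 d0 e0 h.
Qed.

(** Rounding x and y to the grid of mesh 1 / N moves the product x y by O(1 / N)
    when x and y are bounded. *)
Lemma mul_close (x y p q M N : R) : 1 <= N -> `|x * N - p| <= 1 -> `|y * N - q| <= 2 ->
  `|p| <= M * N -> `|q| <= 2 * (M * N) -> `|x * y * N - p * q / N| <= 4 * M + 2.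
Proof.
move=> N1 hx hy hp hq; have N0 : 0 < N by apply: lt_le_trans N1.
rewrite -(ler_pM2r N0) -[X in _ * X <= _](gtr0_norm N0) -normrM.
have -> : (x * y * N - p * q / N) * N =
   (x * N - p) * (y * N - q) + p * (y * N - q) + (x * N - p) * q.
  by field; rewrite gt_eqF.
have h1 : `|(x * N - p) * (y * N - q)| <= 2 * N.
  by rewrite normrM; apply: (@le_trans _ _ (1 * 2)); [exact: ler_pM|rewrite mul1r ler_peMr].
have h2 : `|p * (y * N - q)| <= (M * N) * 2 by rewrite normrM; exact: ler_pM.
have h3 : `|(x * N - p) * q| <= 1 * (2 * (M * N)) by rewrite normrM; exact: ler_pM.
apply: le_trans (ler_normD _ _) _; apply: le_trans (lerD (ler_normD _ _) (lexx _)) _.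
have -> : (4 * M + 2) * N = 2 * N + (M * N) * 2 + 1 * (2 * (M * N)) by ring.
by rewrite !lerD.
Qed.

Lemma dot_set_gt0 E F H : compact E -> compact F -> compact H ->
  (4%:E < hausdorff_dim E + hausdorff_dim F + hausdorff_dim H)%E ->
  (0 < lebesgue_measure (dot_set E (sum_set F H)))%E.
Proof.
move=> cE cF cH dim4.
have [bE hbE] := compact_boxed cE; have [bF hbF] := compact_boxed cF.
have [bH hbH] := compact_boxed cH.
pose b := maxn bE (maxn bF bH).
have bxE : boxed b E by apply: boxed_le hbE; rewrite leq_maxl.
have bxF : boxed b F by apply: boxed_le hbF; rewrite leq_max leq_maxl orbT.
have bxH : boxed b H by apply: boxed_le hbH; rewrite !leq_max leqnn !orbT.
have [a dE /andP[a0 a2]] := hausdorff_dim_fin bxE.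
have [a' dF /andP[a'0 a'2]] := hausdorff_dim_fin bxF.
have [a'' dH /andP[a''0 a''2]] := hausdorff_dim_fin bxH.
rewrite dE dF dH -!EFinD lte_fin in dim4.
(* Shrinking all three dimensions by the factor th keeps their sum above 4. *)
pose th := (1 + 4 / (a + a' + a'')) / 2.
have S0 : 0 < a + a' + a'' by lra.
have th1 : th < 1.
  rewrite /th ltr_pdivrMr// mul1r -ltrBrDl ltr_pdivrMr//; lra.
have th0 : 0 < th by rewrite /th divr_gt0// ltr_pwDl// divr_ge0// ltW.
have thS : 4 < th * (a + a' + a'').
  have -> : th * (a + a' + a'') = (a + a' + a'' + 4) / 2 by rewrite /th; field; rewrite gt_eqF.
  by lra.
have weights X d : boxed b X -> hausdorff_dim X = d%:E -> 0 < d ->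
    exists2 c : R, 0 < c & forall k, frostman_weights b k X c (2 `^ (- (th * d))).
  move=> bX dX d0; apply: frostman_of_dim => //; first exact: mulr_gt0.
  by rewrite dX lte_fin gtr_pMl.
have [cE0 cE0p frE] := weights E a bxE dE ltac:(lra).
have [cF0 cF0p frF] := weights F a' bxF dF ltac:(lra).
have [cH0 cH0p frH] := weights H a'' bxH dH ltac:(lra).
set al := 2 `^ (- (th * a)) in frE.
set be := 2 `^ (- (th * a')) in frF.
set ga := 2 `^ (- (th * a'')) in frH.
have al0 : 0 <= al by apply: powR_ge0.
have be0 : 0 <= be by apply: powR_ge0.
have ga0 : 0 <= ga by apply: powR_ge0.
have al1 : al < 1 by apply: pow2N_lt1; apply: mulr_gt0 => //; lra.
have x1 : 16 * (al * be * ga) < 1.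
  have -> : 16 = 2 `^ 4 :> R by rewrite powR_mulrn// -natrX.
  have two0 (s t : R) : 2 `^ s * 2 `^ t = 2 `^ (s + t).
    by rewrite powRD// pnatr_eq0 implybT.
  rewrite /al /be /ga !two0.
  have -> : 4 + (- (th * a) - th * a' - th * a'') = - (th * (a + a' + a'') - 4) by ring.
  by apply: pow2N_lt1; rewrite subr_gt0.
(* Cells within 2 ^ - r of the origin carry at most half of the mass of E. *)
have [r hr] := exists_exp_le al0 al1 (divr_gt0 cE0p (ltr0n R 50 : 0 < 50)).
pose D : R := 8 * (25 ^+ 6 + 256 * 25 ^+ 6 * (32 * (2 ^ b) ^ 2 + 16)%:R ^+ 3 *
   (8 * 2 ^ r * (2 ^ b).+1 ^ 2)%:R / (1 - 16 * (al * be * ga))).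
have D0 : 0 < D.
  rewrite /D; apply: mulr_gt0; first by rewrite ltr0n.
  apply: ltr_wpDr; last by apply: exprn_gt0; rewrite ltr0n.
  apply: divr_ge0; last by rewrite subr_ge0 ltW.
  apply: mulr_ge0; last exact: ler0n.
  apply: mulr_ge0; last by apply: exprn_ge0; exact: ler0n.
  by apply: mulr_ge0; last apply: exprn_ge0; rewrite ler0n.
pose W := cE0 / 2 * cF0 * cH0.
have W0 : 0 < W by rewrite /W !mulr_gt0.
apply: (@lebesgue_gt0 R _ (W ^+ 2 / D) (8 * (2 ^ b)%:R + 5) r).
- exact: dot_set_compact.
- by rewrite divr_gt0// exprn_gt0.
move=> k rk.
have [M [mu [p1 [p2 [mu0 /andP[muge mule] pX mub posE]]]]] := frE k.
have [L [nu [q1 [q2 [nu0 /andP[nuge nule] qX nub posF]]]]] := frF k.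
have [T [la [r1 [r2 [la0 /andP[lage lale] rX lab posH]]]]] := frH k.
have hr' : 25 * al ^+ r <= cE0 / 2.
  by move: hr; rewrite ler_pdivlMr// => hr; lra.
have [mu' [mu'mu mu'ge mu'b far]] := far_restrict mu0 mub rk hr' muge.
have mu'0 u : 0 <= mu' u by case/andP: (mu'mu u).
have le25 (x : R) : x <= 1 -> x <= 25 by move=> h; apply: le_trans h _; rewrite ler1n.
have mu'le : \sum_m mu' m <= 25.
  apply: le25; apply: le_trans mule; apply: ler_sum => u _.
  by case/andP: (mu'mu u).
have C0 : 0 <= 25 :> R by [].
have en := energy_le C0 al0 be0 ga0 mu'0 nu0 la0 mu'le (le25 _ nule) (le25 _ lale)
  (fun m => (pX m).1) (fun m => (pX m).2) (fun m => (qX m).1) (fun m => (qX m).2)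
  (fun m => (rX m).1) (fun m => (rX m).2) far mu'b nub lab x1.
set N := (2 ^ k)%N in en *.
have N0 : (0 < N)%N by rewrite expn_gt0.
pose w (u : M * L * T) := mu' u.1.1 * nu u.1.2 * la u.2.
pose s (u : M * L * T) : int :=
  p1 u.1.1 * (q1 u.1.2 + r1 u.2) + p2 u.1.1 * (q2 u.1.2 + r2 u.2).
have {}en : \sum_u \sum_(v | `|s u - s v| < N%:Z) w u * w v <= D / N%:R by exact: en.
have w0 u : 0 <= w u by rewrite /w !mulr_ge0.
have Wle : W <= \sum_u w u.
  have -> : \sum_u w u = (\sum_m mu' m) * (\sum_l nu l) * (\sum_h la h).
    by rewrite big_distrlr /= pair_big big_distrlr /= pair_big.
  by rewrite /W !ler_pM ?mulr_ge0 ?divr_ge0 ?(ltW cE0p) ?(ltW cF0p) ?(ltW cH0p).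
exists (undup [seq (s u %/ N)%Z | u <- enum {: M * L * T}]).
  split; first exact: undup_uniq.
  have h := sqr_sum_le_size s N0 w0.
  have Nr : 0 < N%:R :> R by rewrite ltr0n.
  have DN : 0 < D / N%:R by rewrite divr_gt0.
  rewrite mulrAC -[leLHS]mulrA -invf_div ler_pdivrMr//.
  apply: (@le_trans _ _ ((\sum_u w u) ^+ 2)).
    by rewrite ler_sqr ?nnegrE ?(ltW W0)// (le_trans (ltW W0)).
  by apply: le_trans h _; rewrite ler_wpM2l.
move=> t; rewrite mem_undup => /mapP[[[m l] h] _ ->].
have [x Ex [x0 x1']] := posE m; have [y Fy [y0 y1]] := posF l.
have [z Hz [z0 z1]] := posH h.
exists (dotv x (y + z)).
  by exists x => //; exists (y + z) => //; exists y => //; exists z.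
have N1 : 1 <= N%:R :> R by rewrite ler1n.
have natz (n : nat) : n%:R = (n%:Z)%:~R :> R by [].
have sumX (i j : int) : `|i| <= (2 ^ b * N)%:Z -> `|j| <= (2 ^ b * N)%:Z ->
    `|(i + j)%:~R| <= 2 * ((2 ^ b)%:R * N%:R) :> R.
  move=> hi hj; rewrite -natrM -(natrM _ 2) -intr_norm [leRHS]natz ler_int.
  apply: le_trans (ler_normD _ _) (le_trans (lerD hi hj) _).
  by rewrite -PoszD addnn -mul2n.
have absX (i : int) : `|i| <= (2 ^ b * N)%:Z -> `|i%:~R| <= (2 ^ b)%:R * N%:R :> R.
  by move=> hi; rewrite -natrM -intr_norm [leRHS]natz ler_int.
have close2 (u v : R) (i j : int) : `|u * N%:R - i%:~R| <= 1 -> `|v * N%:R - j%:~R| <= 1 ->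
    `|(u + v) * N%:R - (i + j)%:~R| <= 2.
  move=> hu hv; rewrite (_ : _ - _ = (u * N%:R - i%:~R) + (v * N%:R - j%:~R)); last first.
    by rewrite rmorphD /=; ring.
  by apply: le_trans (ler_normD _ _) _; lra.
have h0 := mul_close N1 x0 (close2 _ _ _ _ y0 z0) (absX _ (pX m).1) (sumX _ _ (qX l).1 (rX h).1).
have h1 := mul_close N1 x1' (close2 _ _ _ _ y1 z1) (absX _ (pX m).2) (sumX _ _ (qX l).2 (rX h).2).
have Nz0 : 0 < N%:Z by rewrite ltz_nat.
have Nr : 0 < N%:R :> R by rewrite ltr0n.
have h2 : `|(s (m, l, h))%:~R / N%:R - ((s (m, l, h) %/ N)%Z)%:~R| <= 1 :> R.
  rewrite {1}(divz_eq (s (m, l, h)) N) rmorphD rmorphM /= mulrDl mulfK ?gt_eqF//.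
  rewrite addrAC subrr add0r ger0_norm; last first.
    by rewrite divr_ge0 ?ler0n// ler0z modz_ge0// gt_eqF.
  rewrite ler_pdivrMr// mul1r -[N%:R]/((N%:Z)%:~R) ler_int.
  exact: ltW (ltz_pmod _ Nz0).
have sE : (s (m, l, h))%:~R = (p1 m)%:~R * (q1 l + r1 h)%:~R +
    (p2 m)%:~R * (q2 l + r2 h)%:~R :> R by rewrite /s [LHS]intrD !intrM.
rewrite dotv2 !mxE.
set d0 := x ord0 i0 * _; set d1 := x ord0 i1 * _.
set u0 := _ - _ in h0; set u1 := _ - _ in h1; set u2 := _ - _ in h2.
rewrite (_ : _ - _ = u0 + u1 + u2); last first.
  by rewrite /u0 /u1 /u2 sE /d0 /d1; ring.
apply: le_trans (ler_normD _ _) _; apply: le_trans (lerD (ler_normD _ _) (lexx _)) _.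
by lra.
Qed.

End main.

Local Open Scope ereal_scope.

Theorem theorem1p4 (R : realType) :
  (forall E F H : set 'rV[R]_2,
     compact E -> compact F -> compact H ->
     4%:E < hausdorff_dim E + hausdorff_dim F + hausdorff_dim H ->
     0 < lebesgue_measure (dot_set E (sum_set F H))) /\
  (exists E F H : set 'rV[R]_2,
     [/\ compact E, compact F & compact H] /\
     hausdorff_dim E + hausdorff_dim F + hausdorff_dim H = 4%:E /\
     lebesgue_measure (dot_set E (sum_set F H)) = 0).
Proof.
split; first by move=> E F H; exact: dot_set_gt0.
exists [set 0%R], (@square R), (@square R); split; last split.
- by split; [exact: compact_set1 | exact: square_compact | exact: square_compact].
- by rewrite hausdorff_dim_set1 hausdorff_dim_square add0e -EFinD -natrD.
rewrite (_ : dot_set _ _ = [set 0%R]) ?lebesgue_measure_set1//.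
have zero_dot (v : 'rV[R]_2) : dotv 0%R v = 0%R by rewrite dotv2 !mxE !mul0r addr0.
apply/seteqP; split=> [_ [_ -> [v _ <-]]|_ ->]; first exact: zero_dot.
have sq0 : @square R 0%R by move=> i; rewrite /= mxE in_itv /= lexx ler01.
exists 0%R => //; exists (0 + 0)%R; last exact: zero_dot.
by exists 0%R => //; exists 0%R.
Qed.
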